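(* Let $P,Q\in\mathbb{C}[x,y]$ be polynomials of degree $m>1$ without a common nonconstant polynomial factor, and let $C$ be an algebraic invariant curve of degree $n$ of the system $\dot x=P(x,y)$, $\dot y=Q(x,y)$. Suppose that all singular points of $C$ are nodes. Then $$n\leq 2(m+1).$$
   Context: An algebraic invariant curve of the system is the curve $C$ given by $f(x,y)=0$, where $f\in\mathbb{C}[x,y]$ is an irreducible (nonconstant) polynomial such that $P\frac{\partial f}{\partial x}+Q\frac{\partial f}{\partial y}=kf$ for some $k\in\mathbb{C}[x,y]$; its degree is $n=\deg f$. The curve is considered in $\mathbb{C}\mathbb{P}^2$ (projective closure), so its singular points include those on the line at infinity. A node is an ordinary double point. *)

(* Defs.v *)
From mathcomp Require Import all_boot all_order all_algebra.
From mathcomp Require Import reals complex mpoly.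
Set Implicit Arguments.
Unset Strict Implicit.
Unset Printing Implicit Defensive.
Import GRing.Theory.
Local Open Scope ring_scope.

(* Note that [msize p] is [1 + deg p] for [p != 0], and [msize 0 = 0]. *)

Section Plane_curves.
Context (K : fieldType).

Definition irreducible_mpoly (n : nat) (f : {mpoly K[n]}) : Prop :=
  (1 < msize f)%N /\
  forall g h : {mpoly K[n]},
    f = g * h -> (msize g <= 1)%N \/ (msize h <= 1)%N.

Definition no_common_factor (n : nat) (p q : {mpoly K[n]}) : Prop :=
  forall d p' q' : {mpoly K[n]}, p = d * p' -> q = d * q' -> (msize d <= 1)%N.

Definition invariant_curve (P Q f : {mpoly K[2]}) : Prop :=
  irreducible_mpoly f /\
  exists k : {mpoly K[2]}, P * f^`M(0) + Q * f^`M(1) = k * f.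

(* F(x, y, z) = z ^ (deg f) * f(x / z, y / z), the last variable being z. *)
Definition homogenize (f : {mpoly K[2]}) : {mpoly K[3]} :=
  \sum_(d < msize f)
    mwiden (pihomog mdeg d f) * 'X_ord_max ^+ ((msize f).-1 - d).

(* Points of the projective plane are given by homogeneous coordinates,
   i.e. by nonzero vectors of K^3. *)
Definition projective_singular_point (F : {mpoly K[3]}) (p : 'I_3 -> K) : Prop :=
  [/\ exists i, p i != 0, F.@[p] = 0 & forall i, (F^`M(i)).@[p] = 0].

(* The equation of F = 0 in the affine chart where the i-th coordinate is 1;
   the two other coordinates are kept in their order. *)
Definition dehomogenize (i : 'I_3) (F : {mpoly K[3]}) : {mpoly K[2]} :=
  F \mPo [tuple if unlift i j is Some k then 'X_k else 1 | j < 3].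

Definition chart_point (i : 'I_3) (p : 'I_3 -> K) : 'I_2 -> K :=
  fun k => p (lift i k) / p i.

Definition translate (g : {mpoly K[2]}) (a : 'I_2 -> K) : {mpoly K[2]} :=
  g \mPo [tuple 'X_j + (a j)%:MP | j < 2].

(* The curve g = 0 has multiplicity 2 at a, with two distinct tangents
   l1 = 0 and l2 = 0. *)
Definition ordinary_double_point (g : {mpoly K[2]}) (a : 'I_2 -> K) : Prop :=
  let t := translate g a in
  [/\ pihomog mdeg 0 t = 0,
      pihomog mdeg 1 t = 0 &
      exists l1 l2 : {mpoly K[2]},
        [/\ l1 \is 1.-homog, l2 \is 1.-homog,
            forall c1 c2 : K, c1 *: l1 + c2 *: l2 = 0 -> c1 = 0 /\ c2 = 0 &
            pihomog mdeg 2 t = l1 * l2]].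

(* Being an ordinary double point does not depend on the affine chart. *)
Definition projective_node (F : {mpoly K[3]}) (p : 'I_3 -> K) : Prop :=
  exists2 i, p i != 0 &
    ordinary_double_point (dehomogenize i F) (chart_point i p).

End Plane_curves.

(* Main.v *)
From HB Require Import structures.
Require Import Defs.
From mathcomp Require Import all_boot all_order all_algebra.
From mathcomp Require Import reals complex mpoly ring zify.
Set Implicit Arguments.
Unset Strict Implicit.
Unset Printing Implicit Defensive.
Import Order.TTheory GRing.Theory Num.Theory.
Local Open Scope ring_scope.

(** The bound is a statement about syzygies. Let F be the homogenization of f,
    a form of degree n. Homogenizing P f_x + Q f_y = k f and subtracting from the
    vector field the multiple of the Euler field dictated by k gives a nonzero
    triple V of forms of degree m with V . grad F = 0 ([invariant_syzygyP],
    [invariant_syzygy_neq0]). So it suffices that a plane curve with only nodes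
    has no nonzero syzygy of degree m among its partial derivatives when
    n > 2m + 2; this is [low_degree_syzygy_eq0].

    Let X be the vector of coordinates and W = V x X, a triple of forms of degree
    m + 1. Euler's identity X . grad F = n F and the syzygy give
    W x grad F = - n F V ([cross_grad]), so W and grad F are proportional along
    the curve. Differentiating V . grad F = 0 at a singular point p shows that
    V(p) lies in the kernel of the Hessian; at a node this kernel is spanned by p
    ([nodal_hessian_kernel]), so V(p) is proportional to p and W(p) = 0
    ([cross_vanishes]). Near a node the partial derivatives generate the full
    ideal of the point, so each W_j lies locally in the Jacobian ideal, hence
    globally in any affine chart that contains all the singular points
    ([cross_in_jacobian_ideal]): W_j is a sum of k_i F_i.

    Take as line at infinity of the chart a line transverse to the curve, let a
    be a point of that line off the curve, and write F_a and W_a for the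
    combinations a . grad F and a . W. As W_a F_i = W_i F_a modulo F, the product
    W_j W_a lies in (F, F_a). Transversality says that F and F_a have coprime
    restrictions to the line at infinity, so that a combination of F and F_a of
    degree at most n - 1 can only be a constant multiple of F_a
    ([graded_lead_eliminate]). The degree of W_j W_a is 2m + 2 <= n - 1, whence
    W_j W_a = b_j F_a with b_j constant. The relation X . W = 0 then forces
    b_j = 0, so W_a = 0; next W_j F_a is a multiple of F, and the same coprimality
    gives W_j = 0 for degree reasons; finally n F V = 0, so V = 0.

    A transverse line exists because f is irreducible: for a direction off the
    curve, the resultant of f and of its derivative in that direction, as
    polynomials along the parallel lines, is nonzero by Gauss's lemma
    ([pencil_resultant_neq0]). Two such lines are used: the second one shows that
    the curve and its polar meet in finitely many points of the chart
    ([chart_resultant_neq0]), the input of an elementary two-variable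
    Nullstellensatz ([nullstellensatz2]).

    Bivariate polynomials are elements of K[w][v]. Total degrees are read off
    after the substitution v = s t, w = t into K[s][t] ([blowup]): a polynomial of
    total degree d becomes a polynomial of degree d in t, whose leading
    coefficient, in K[s], is the restriction of the top form to the line at
    infinity. *)

(** * Multivariate polynomials: induction, Euler, Taylor, substitution *)

Lemma submm n (m : 'X_{1..n}) : (m - m = 0)%MM.
Proof. by apply/mnmP=> k; rewrite mnmBE subnn mnm0E. Qed.

Section Mpoly.
Variables (n : nat) (R : comNzRingType).
Implicit Types p q : {mpoly R[n]}.

(** Induction over the ring structure, which suits statements that are stable
    under products better than induction over monomials. *)
Lemma mpoly_ring_ind (P : {mpoly R[n]} -> Prop) :
  (forall c, P c%:MP) -> (forall i, P 'X_i) ->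
  (forall p q, P p -> P q -> P (p + q)) ->
  (forall p q, P p -> P q -> P (p * q)) -> forall p, P p.
Proof.
move=> PC PX PD PM p; rewrite [p]mpolyE.
apply: (big_ind P) => [|*|m _]; [by rewrite -mpolyC0|exact: PD|].
rewrite -mul_mpolyC; apply: (PM) => //; rewrite mpolyXE_id.
apply: (big_ind P) => [|*|i _]; [by rewrite -mpolyC1|exact: PM|].
by elim: (m i) => [|k IH]; rewrite ?expr0 ?exprS -?mpolyC1 //; apply: PM.
Qed.

Lemma eq_rmorph_mpoly (S : comNzRingType) (f g : {rmorphism {mpoly R[n]} -> S}) :
  (forall c, f c%:MP = g c%:MP) -> (forall i, f 'X_i = g 'X_i) -> f =1 g.
Proof.
move=> fgC fgX; apply: mpoly_ring_ind => // p q fgp fgq.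
  by rewrite !rmorphD fgp fgq.
by rewrite !rmorphM fgp fgq.
Qed.

Lemma mmapXU (S : comNzRingType) (f : {rmorphism R -> S}) h i :
  mmap f h ('X_i : {mpoly R[n]}) = h i.
Proof. by rewrite mmapX mmap1U. Qed.

Lemma eq_mmap (S : comNzRingType) (f g : R -> S) h k p :
  f =1 g -> h =1 k -> mmap f h p = mmap g k p.
Proof.
move=> fg hk; rewrite /mmap; apply: eq_bigr => m _.
by rewrite fg (mmap1_eq _ hk).
Qed.

Lemma rmorph_mmap (S T : comNzRingType) (g : {rmorphism S -> T}) (f : R -> S) h p :
  g (mmap f h p) = mmap (g \o f) (g \o h) p.
Proof.
rewrite /mmap rmorph_sum; apply: eq_bigr => m _.
rewrite rmorphM rmorph_prod /=; congr (_ * _).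
by apply: eq_bigr => i _; rewrite rmorphXn.
Qed.

Lemma dhomog_mderiv d p i : p \is d.-homog -> p^`M(i) \is d.-1.-homog.
Proof.
move=> hp; apply/dhomogP => m; rewrite mcoeff_msupp mcoeff_mderiv => nz.
have /(dhomog_mf hp) : (m + U_(i))%MM \in msupp p.
  by rewrite mcoeff_msupp; apply: contraNneq nz => ->; rewrite mul0rn.
by rewrite /= mdegD mdeg1 addn1 => <-.
Qed.

Lemma dhomogXU (i : 'I_n) : ('X_i : {mpoly R[n]}) \is 1.-homog.
Proof. by rewrite dhomogX /= mdeg1. Qed.

Lemma euler_dhomog d p : p \is d.-homog -> \sum_i 'X_i * p^`M(i) = p *+ d.
Proof.
move=> hp; rewrite [in RHS](mpolyE p) -sumrMnl.
rewrite (eq_bigr (fun i => \sum_(m <- msupp p) p@_m *: ((m i)%:R *: 'X_[m])))=> [|i _].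
  rewrite exchange_big /=; rewrite !big_seq; apply: eq_bigr => m mp.
  rewrite -scaler_sumr -scaler_suml -natr_sum -mdegE (dhomog_mf hp mp).
  by rewrite scaler_nat scalerMnr.
rewrite {1}(mpolyE p) raddf_sum /= mulr_sumr; apply: eq_bigr => m _.
rewrite mderivZ mderivX -!scalerAr -mpolyXD; congr (_ *: _).
have [->|mi] := posnP (m i); first by rewrite !scale0r.
congr (_ *: 'X_[_]); apply/mnmP => j; rewrite mnmDE mnmBE mnm1E.
by case: eqP => [<-|_] /=; rewrite ?subn0 // addnC subnK.
Qed.

Lemma meval_dhomogZ d p (c : R) v :
  p \is d.-homog -> p.@[fun i => c * v i] = c ^+ d * p.@[v].
Proof.
move=> hp; rewrite !mevalE mulr_sumr !big_seq; apply: eq_bigr => m mp.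
rewrite mulrCA; congr (_ * _); rewrite -(dhomog_mf hp mp) /= mdegE.
rewrite -prodrXr -big_split /=; apply: eq_bigr => i _.
by rewrite exprMn.
Qed.

(** First-order Taylor expansion; the remainder is hidden in the coefficients
    A i, which are polynomials known only through their value at a. *)
Lemma taylor_mpoly p (a : 'I_n -> R) :
  exists A : 'I_n -> {mpoly R[n]},
    p = p.@[a]%:MP + \sum_i A i * ('X_i - (a i)%:MP) /\
    forall i, (A i).@[a] = p^`M(i).@[a].
Proof.
elim/mpoly_ring_ind: p => [c|j|p q [A [pE Aa]] [B [qE Ba]]|p q [A [pE Aa]] [B [qE Ba]]].
- exists (fun=> 0); rewrite mevalC big1 ?addr0 => [|i _]; last by rewrite mul0r.
  by split=> // i; rewrite mderivC meval0.
- exists (fun i => (i == j)%:R); rewrite mevalXU (bigD1 j) //= eqxx mul1r.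
  rewrite big1 => [|i /negbTE->]; last by rewrite mul0r.
  rewrite addr0 addrC subrK; split=> // i.
  rewrite mderivX mevalZ mnm1E eq_sym; case: eqP => [->|_] /=.
    by rewrite submm mpolyX0 !meval1 mul1r.
  by rewrite meval0 mul0r.
- exists (fun i => A i + B i); split=> [|i]; last by rewrite mderivD !mevalD Aa Ba.
  rewrite mevalD mpolyCD {1}pE {1}qE addrACA -big_split /=.
  by congr (_ + _); apply: eq_bigr => i _; rewrite mulrDl.
exists (fun i => A i * q + p.@[a]%:MP * B i); split=> [|i]; last first.
  by rewrite mderivM !mevalD !mevalM mevalC Aa Ba.
rewrite mevalM mpolyCM {1}pE mulrDl {1}qE mulrDr -addrA; congr (_ + _).
rewrite mulr_sumr mulr_suml -big_split /=; apply: eq_bigr => i _; ring.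
Qed.
End Mpoly.

Section MpolyPoints.
Variable (K : numFieldType).

Lemma poly_neq0_point (p : {poly K}) : p != 0 -> exists x, p.[x] != 0.
Proof.
move=> p0; have /allPn [x _ px] : ~~ all (root p) [seq i%:R | i <- iota 0 (size p)].
  apply/negP => /(max_poly_roots p0).
  rewrite map_inj_in_uniq ?iota_uniq => [/(_ isT)|x y _ _ /eqP].
    by rewrite size_map size_iota ltnn.
  by rewrite eqr_nat => /eqP.
by exists x.
Qed.

Lemma muni_eq0 n (p : {mpoly K[n.+1]}) : (muni p == 0) = (p == 0).
Proof.
apply/eqP/eqP => [p0|->]; last exact: muni0.
apply/mpolyP => m; rewrite mcoeff0.
have [mp|/memN_msupp_eq0 //] := boolP (m \in msupp p).
have := congr1 (fun q : {poly {mpoly K[n]}} =>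
  q`_(m ord_max)@_[multinom (m (widen_ord (leqnSn n) i)) | i < n]) p0.
rewrite coef0 mcoeff0 muniE coef_sum raddf_sum /= (bigD1_seq m) //= ?msupp_uniq //.
rewrite coefZ coefXn eqxx mulr1 mcoeffZ mcoeffX eqxx mulr1 big1 ?addr0 // => k km.
rewrite coefZ coefXn; case: eqP => [e|_]; last by rewrite mulr0 mcoeff0.
rewrite mulr1 mcoeffZ mcoeffX; case: eqP => [/mnmP e'|_]; last by rewrite mulr0.
case/eqP: km; apply/mnmP => i; case: (unliftP ord_max i) => [j|] -> //.
by have := e' j; rewrite !mnmE; congr (_ = _); congr (_ _); apply: val_inj; rewrite /= /bump leqNgt ltn_ord.
Qed.

Lemma meval_muni n (p : {mpoly K[n.+1]}) (v : 'I_n -> K) (c : K) :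
  (map_poly (meval v) (muni p)).[c] = p.@[fun i => oapp v c (unlift ord_max i)].
Proof.
elim/mpoly_ring_ind: p => [a|i|p q IHp IHq|p q IHp IHq].
- by rewrite muniC map_polyC /= hornerC !mevalC.
- rewrite mevalXU /muni mmapX mmap1U; case: splitP => j /= ij.
    rewrite map_polyC hornerC /= mevalXU (_ : i = lift ord_max j) ?liftK //.
    by apply: val_inj; rewrite /= /bump leqNgt ltn_ord add0n -ij.
  rewrite map_polyX hornerX (_ : i = ord_max) ?unlift_none //.
  by apply: val_inj; rewrite /= ij ord1 addn0.
- by rewrite mevalD -IHp -IHq (raddfD (@muni n K)) rmorphD hornerD.
- by rewrite mevalM -IHp -IHq (rmorphM (@muni n K)) rmorphM hornerM.
Qed.

(** Induction on the number of variables: a point where the leading coefficient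
    in the last variable does not vanish leaves a nonzero polynomial in one
    variable. *)
Lemma mpoly_neq0_point n (p : {mpoly K[n]}) : p != 0 -> exists v, p.@[v] != 0.
Proof.
elim: n p => [|n IH] p p0.
  have pc : p = (p@_0)%:MP.
    by apply/mpolyP => m; rewrite mcoeffC (_ : m = 0%MM) ?eqxx ?mulr1 //; apply/mnmP => -[].
  by exists (fun=> 0); move: p0; rewrite pc mevalC mpolyC_eq0.
have : muni p != 0 by rewrite muni_eq0.
rewrite -lead_coef_eq0 => /IH [v vp].
have /poly_neq0_point [c] : map_poly (meval v) (muni p) != 0.
  by apply: contraNneq vp => /(congr1 (fun q : {poly K} => q`_(size (muni p)).-1));
     rewrite coef_map coef0 /= => ->.
by rewrite meval_muni; exists (fun i => oapp v c (unlift ord_max i)).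
Qed.

Lemma mpoly_eq0_points n (p : {mpoly K[n]}) : (forall v, p.@[v] = 0) -> p = 0.
Proof.
move=> p0; apply/eqP; apply: contraT => /mpoly_neq0_point [v].
by rewrite p0 eqxx.
Qed.
End MpolyPoints.

Section Subst.
Variables (n : nat) (K : comNzRingType) (A : comNzRingType) (f : {rmorphism K -> A}).

(** The coefficient of degree d of a polynomial of degree at most d; unlike the
    leading coefficient, it is allowed to vanish and is multiplicative. *)
Definition top_coef d x (u : {poly A}) := (size u <= d.+1)%N /\ u`_d = x.

Lemma top_coefM a b x y u v :
  top_coef a x u -> top_coef b y v -> top_coef (a + b) (x * y) (u * v).
Proof.
move=> [ua <-] [vb <-]; split.
  apply: leq_trans (size_polyMleq _ _) _.
  by rewrite -subn1 leq_subLR; apply: leq_trans (leq_add ua vb) _; lia.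
have ha : (a < (a + b).+1)%N by rewrite ltnS leq_addr.
rewrite coefM (bigD1 (Ordinal ha)) //= addKn big1 ?addr0 // => j ja.
have {}ja : (j : nat) <> a by move=> e; case/eqP: ja; apply: val_inj.
have [lt|le] := ltnP j a; last first.
  by rewrite nth_default ?mul0r //; apply: leq_trans ua _; lia.
by rewrite [X in _ * X]nth_default ?mulr0 //; apply: leq_trans vb _; lia.
Qed.

Lemma top_coefX a x u k : top_coef a x u -> top_coef (a * k) (x ^+ k) (u ^+ k).
Proof.
move=> ux; elim: k => [|k IH]; first by rewrite muln0 /top_coef !expr0 size_poly1 coef1.
by rewrite !exprS mulnS; apply: top_coefM.
Qed.

(** Restricting a form p of degree d to a line a + t b gives a polynomial of
    degree d in t, with top coefficient p(b). *)
Lemma coef_mmap_top d (h : 'I_n -> {poly A}) (p : {mpoly K[n]}) :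
  (forall i, size (h i) <= 2)%N -> p \is d.-homog ->
  top_coef d (mmap f (fun i => (h i)`_1) p) (mmap (polyC \o f) h p).
Proof.
move=> h2 hp; rewrite /mmap !big_seq.
apply: (big_rec2 (top_coef d)) => [|m x u mp [ux <-]].
  by rewrite /top_coef size_poly0 coef0.
suff [tm1 <-] : top_coef d (f p@_m * mmap1 (fun i => (h i)`_1) m) ((f p@_m)%:P * mmap1 h m).
  by split; rewrite ?coefD //; apply: leq_trans (size_polyD _ _) _; rewrite geq_max tm1.
have -> : d = (0 + \sum_i 1 * m i)%N.
  by rewrite -(dhomog_mf hp mp) /= mdegE add0n; apply: eq_bigr => i _; rewrite mul1n.
apply: top_coefM; first by split; rewrite ?coefC // size_polyC; case: eqP.
apply: (big_rec3 (fun d x u => top_coef d x u)) => [|i e y v _ IH].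
  by rewrite /top_coef size_poly1 coef1.
by apply: top_coefM => //; apply: top_coefX; split.
Qed.
End Subst.

(** * A Nullstellensatz for two variables *)

Section Ideals.
Variable B : comNzRingType.

Definition is_ideal (I : B -> Prop) :=
  (forall u v, I u -> I v -> I (u + v)) /\ (forall a v, I v -> I (a * v)).

(** If every factor of a product in I is invertible modulo I, then the product
    is too, so I is the unit ideal. *)
Lemma ideal_prod_unit (T : Type) (I : B -> Prop) (l : T -> B) (s : seq T) :
  is_ideal I -> I (\prod_(x <- s) l x) -> (forall x, exists k, I (1 - k * l x)) ->
  I 1.
Proof.
move=> [ID IM] Is Il; elim: s Is => [|x s IH]; first by rewrite big_nil.
rewrite big_cons => Is; apply: IH; have [k Ik] := Il x.
set P := \prod_(_ <- _) _ in Is *.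
have -> : P = P * (1 - k * l x) + k * (l x * P) by ring.
by apply: ID; apply: IM.
Qed.
End Ideals.

Section Bivariate.
Variable K : closedFieldType.
Implicit Types g f : {poly {poly K}}.

(** b is the value of the inner variable w, and c that of the outer variable v. *)
Definition eval2 (b c : K) : {poly {poly K}} -> K := horner_eval b \o horner_eval c%:P.
HB.instance Definition _ b c := GRing.RMorphism.on (eval2 b c).

Lemma poly_taylor1 (A : comNzRingType) (p : {poly A}) (a : A) :
  exists q, p = p.[a]%:P + q * ('X - a%:P).
Proof.
have /factor_theorem [q qE] : root (p - p.[a]%:P) a.
  by rewrite rootE hornerD hornerN hornerC subrr.
by exists q; rewrite -qE addrC subrK.
Qed.

Lemma eval2_taylor b c g : exists k1 k2,
  g = (eval2 b c g)%:P%:P + k1 * ('X - b%:P)%:P + k2 * ('X - c%:P%:P).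
Proof.
have [k2 gE] := poly_taylor1 g c%:P.
have [k1 hE] := poly_taylor1 g.[c%:P] b.
exists k1%:P, k2; rewrite {1}gE {1}hE -polyCM -polyCD; congr (_%:P + _).
Qed.

Lemma eval_coef_taylor b g : exists k,
  g = map_poly (polyC \o horner_eval b) g + k * ('X - b%:P)%:P.
Proof.
elim/poly_ind: g => [|g c [k gE]]; first by exists 0; rewrite map_poly0 mul0r addr0.
have [q cE] := poly_taylor1 c b.
exists (k * 'X + q%:P); rewrite rmorphD rmorphM /= map_polyX map_polyC /=.
rewrite [in LHS]gE [in LHS]cE (polyCD _ (q * _)) (polyCM q) /= /horner_eval.
set x := ('X - b%:P)%:P; ring.
Qed.

Lemma ideal_prod_roots (A : comNzRingType) (I : A -> Prop)
    (h : {rmorphism {poly K} -> A}) (r : {poly K}) :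
  is_ideal I -> I (h r) -> r != 0 ->
  exists s : seq K, I (\prod_(z <- s) h ('X - z%:P)).
Proof.
move=> [_ IM] Ir r0; have [s rE] := closed_field_poly_normal r; exists s.
rewrite -rmorph_prod; set P := \prod_(_ <- _) _ in rE *.
have -> : P = (lead_coef r)^-1%:P * r.
  by rewrite {2}rE -mul_polyC mulrA -polyCM mulVf ?lead_coef_eq0 ?mul1r.
by rewrite rmorphM; apply: IM.
Qed.

(** A polynomial r in I that involves w alone splits into linear factors, and it
    is enough to invert each w - b modulo I, that is to show that I + (w - b) is
    the unit ideal. That ideal contains f(b, v), which is not zero because the
    leading coefficient of f in v is a constant, and the same argument in v
    reduces the claim to the ideals I + (w - b, v - c). These are the unit ideal
    as soon as some element of I does not vanish at (b, c). *)
Lemma nullstellensatz2 (I : {poly {poly K}} -> Prop) (r : {poly K})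
    (f : {poly {poly K}}) (c : K) :
  is_ideal I -> I r%:P -> r != 0 -> I f -> lead_coef f = c%:P -> c != 0 ->
  (forall b c, exists2 g, I g & eval2 b c g != 0) -> I 1.
Proof.
move=> Iid Ir r0 If fc c0 Ipt; have [ID IM] := Iid.
have [s Is] := ideal_prod_roots (h := polyC) Iid Ir r0.
apply: (ideal_prod_unit Iid Is) => b.
pose I' g := exists k, I (g - k * ('X - b%:P)%:P).
have I'id : is_ideal I'.
  split=> [u v [k Iu] [l Iv]|a v [k Iv]].
    by exists (k + l); rewrite mulrDl opprD addrACA; apply: ID.
  by exists (a * k); rewrite -mulrA -mulrBr; apply: IM.
pose fb := map_poly (horner_eval b) f.
have fb0 : fb != 0.
  by rewrite -lead_coef_eq0 /fb lead_coef_map_eq fc /= /horner_eval hornerC.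
have I'f : I' (map_poly polyC fb).
  have [k fE] := eval_coef_taylor b f; exists (- k).
  rewrite mulNr opprK -map_poly_comp; by rewrite -fE.
have [s' Is'] := ideal_prod_roots (h := map_poly polyC) I'id I'f fb0.
apply: (ideal_prod_unit I'id Is') => a.
have [g Ig ga] := Ipt b a; have [k1 [k2 gE]] := eval2_taylor b a g.
set x := eval2 b a g in ga gE.
exists (- (k2 * x^-1%:P%:P)), (- (k1 * x^-1%:P%:P)).
rewrite rmorphB /= map_polyX map_polyC /= !mulNr !opprK.
suff -> : 1 + k2 * (x^-1)%:P%:P * ('X - a%:P%:P) + k1 * (x^-1)%:P%:P * ('X - b%:P)%:P = (x^-1)%:P%:P * g.
  exact: IM.
have xx : (x^-1)%:P%:P * x%:P%:P = 1 :> {poly {poly K}} by rewrite -!polyCM mulVf.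
rewrite gE !mulrDr xx; ring.
Qed.

(** * Total degree through a blow-up *)

(** The image of K[w][v] under v = s t, w = t: the coefficient of t ^ k is a
    polynomial in s of degree at most k. *)
Definition graded (g : {poly {poly K}}) := forall k : nat, (size (g`_k)%R <= k.+1)%N.

Lemma gradedD g f : graded g -> graded f -> graded (g + f).
Proof.
move=> gg gf k; rewrite coefD; apply: leq_trans (size_polyD _ _) _.
by rewrite geq_max gg gf.
Qed.

Lemma gradedN g : graded g -> graded (- g).
Proof. by move=> gg k; rewrite coefN size_polyN. Qed.

Lemma gradedM g f : graded g -> graded f -> graded (g * f).
Proof.
move=> gg gf k; rewrite coefM; apply: leq_trans (size_sum _ _ _) _.
apply/bigmax_leqP => i _; apply: leq_trans (size_polyMleq _ _) _.
have := leq_add (gg i) (gf (k - i)%N); have := ltn_ord i; lia.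
Qed.

Lemma graded_monomial (c : {poly K}) e : (size c <= e.+1)%N -> graded (c *: 'X^e).
Proof.
move=> ce k; rewrite coefZ coefXn; case: eqP => [->|_]; first by rewrite mulr1.
by rewrite mulr0 size_poly0.
Qed.

(** The substitution v = s t, w = t, where t is the outer variable of the target
    and s the inner one. *)
Definition blowup : {poly {poly K}} -> {poly {poly K}} :=
  horner_eval ('X%:P * 'X) \o map_poly (map_poly polyC).
HB.instance Definition _ := GRing.RMorphism.on blowup.

Lemma blowupD : {morph blowup : u v / u + v}.
Proof. exact: rmorphD. Qed.

Lemma blowupM : {morph blowup : u v / u * v}.
Proof. exact: rmorphM. Qed.

Lemma blowupX : blowup 'X = 'X *: 'X.
Proof. by rewrite /blowup /= /horner_eval map_polyX hornerX mul_polyC. Qed.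

Lemma blowupC (c : {poly K}) : blowup c%:P = map_poly polyC c.
Proof. by rewrite /blowup /= /horner_eval map_polyC hornerC. Qed.

Lemma blowup_graded g : graded (blowup g).
Proof.
elim/poly_ind: g => [|g c IH]; first by rewrite rmorph0 => k; rewrite coef0 size_poly0.
have -> : blowup (g * 'X + c%:P) = blowup g * ('X *: 'X^1) + map_poly polyC c.
  by rewrite expr1 -blowupX -blowupC -rmorphM -rmorphD.
apply: gradedD; first by apply: (gradedM IH); apply: graded_monomial; rewrite size_polyX.
move=> k; rewrite coef_map /= size_polyC.
by case: eqP.
Qed.

(** If u is not zero, then u f has degree at least n in t, so its leading term
    cancels that of v g. As the leading coefficients of f and g are coprime, the
    one of u is c times the one of g, and (u, v) can be replaced by
    (u - c t^e g, v + c t^e f), which lowers the degree of u. The exponent e is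
    nonnegative precisely because u is graded while the leading coefficient of g
    has the maximal degree n - 1 in s. When u = 0, v has degree 0 in t, and is
    constant because it is graded. *)
Lemma graded_lead_eliminate n f g u v :
  (0 < n)%N -> graded f -> graded g -> graded u -> graded v ->
  size f = n.+1 -> size g = n -> size (lead_coef g) = n ->
  coprimep (lead_coef f) (lead_coef g) ->
  (size (u * f + v * g)%R <= n)%N ->
  exists b : K, u * f + v * g = b%:P%:P * g.
Proof.
move=> n0 gf gg gu gv sf sg slg cop.
have f0 : f != 0 by rewrite -size_poly_eq0 sf.
have g0 : g != 0 by rewrite -size_poly_eq0 sg -lt0n.
have [N] := ubnP (size u); elim: N => // N IH in u v gu gv * => uN le_n.
have [u0|u0] := eqVneq u 0.
  move: le_n; rewrite u0 mul0r add0r => le_n.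
  have [v0|v0] := eqVneq v 0; first by exists 0; rewrite v0 !mul0r.
  have /size1_polyC vE : (size v <= 1)%N by move: le_n; rewrite size_mul // sg -subn1 leq_subLR leq_add2r.
  have /size1_polyC wE : (size (v`_0)%R <= 1)%N by exact: gv.
  by exists v`_0`_0; rewrite {1}vE {1}wE.
have su : size (u * f) = (size u + n)%N by rewrite size_mul // sf addnS.
have u1 : (0 < size u)%N by rewrite size_poly_gt0.
have v0 : v != 0.
  by apply/eqP => v0; move: le_n; rewrite v0 mul0r addr0 su; lia.
have sv : size (v * g) = (size v + n).-1 by rewrite size_mul // sg.
have suv : size (u * f) = size (v * g).
  case: (ltngtP (size (u * f)) (size (v * g))) => // lt.
    by move: le_n; rewrite addrC size_polyDl // sv; lia.
  by move: le_n; rewrite size_polyDl // su; lia.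
have lead0 : lead_coef u * lead_coef f + lead_coef v * lead_coef g = 0.
  rewrite -!lead_coefM !lead_coefE -suv -coefD nth_default // su.
  by apply: leq_trans le_n _; lia.
have /dvdpP [c lu] : lead_coef g %| lead_coef u.
  rewrite -(@Gauss_dvdpl _ _ (lead_coef f)) 1?coprimep_sym //.
  by rewrite (_ : _ * _ = - lead_coef v * lead_coef g) ?dvdp_mull //; apply/eqP; rewrite mulNr -addr_eq0 lead0.
have lg0 : lead_coef g != 0 by rewrite lead_coef_eq0.
have c0 : c != 0 by apply: contraNneq u0 => c0; rewrite -lead_coef_eq0 lu c0 mul0r.
have sc : (size c + n <= (size u).+1)%N.
  have := gu (size u).-1; rewrite -lead_coefE lu size_mul // slg prednK //.
  by move: n0; case: (n) => // k _; rewrite addnS.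
have c1 : (0 < size c)%N by rewrite size_poly_gt0.
pose e := (size u - n)%N; pose k := c *: 'X^e : {poly {poly K}}.
have nu : (n <= size u)%N.
  by rewrite -ltnS; apply: leq_trans sc; rewrite -[n.+1]add1n leq_add2r.
have gk : graded k.
  by apply: graded_monomial; rewrite /e -subSn // -(leq_add2r n) subnK // leqW.
have -> : u * f + v * g = (u - k * g) * f + (v + k * f) * g by ring.
apply: IH.
- by apply: gradedD => //; apply/gradedN/gradedM.
- by apply: gradedD => //; apply: gradedM.
- have skg : size (k * g) = size u.
    by rewrite -scalerAl size_scale // mulrC size_mulXn // sg subnK.
  have lkg : lead_coef (k * g) = lead_coef u.
    by rewrite lead_coefM lu lead_coefZ lead_coefXn mulr1.
  apply: leq_ltn_trans (_ : (size u).-1 < _)%N; last by rewrite prednK.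
  apply/leq_sizeP => j; rewrite leq_eqVlt => /predU1P [<-|lt].
    by rewrite coefB -lead_coefE -[in X in _ - X]skg -lead_coefE lkg subrr.
  by rewrite nth_default //; apply: leq_trans (size_polyD _ _) _; rewrite size_polyN skg maxnn -(prednK u1).
- by rewrite (_ : (u - k * g) * f + (v + k * f) * g = u * f + v * g) //; ring.
Qed.
End Bivariate.

(** * Triples and the cross product *)

Section Triples.
Definition i0 : 'I_3 := @Ordinal 3 0 isT.
Definition i1 : 'I_3 := @Ordinal 3 1 isT.
Definition i2 : 'I_3 := @Ordinal 3 2 isT.

Lemma ord3P (P : 'I_3 -> Prop) : P i0 -> P i1 -> P i2 -> forall i, P i.
Proof.
move=> P0 P1 P2 [[|[|[|//]]] h].
- by rewrite (_ : Ordinal h = i0) //; apply: val_inj.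
- by rewrite (_ : Ordinal h = i1) //; apply: val_inj.
- by rewrite (_ : Ordinal h = i2) //; apply: val_inj.
Qed.

Lemma sum3 (V : nmodType) (F : 'I_3 -> V) : \sum_i F i = F i0 + F i1 + F i2.
Proof.
rewrite !big_ord_recl big_ord0 addr0 addrA.
by congr (F _ + F _ + F _); apply: val_inj.
Qed.

Definition triple (T : Type) (a b c : T) : 'I_3 -> T :=
  fun i => tnth [tuple a; b; c] i.

Lemma eq_triple (T : Type) (a b c : T) (f : 'I_3 -> T) :
  f i0 = a -> f i1 = b -> f i2 = c -> f =1 triple a b c.
Proof. by move=> f0 f1 f2; apply: ord3P. Qed.
End Triples.

Definition cross (A : comNzRingType) (v x : 'I_3 -> A) : 'I_3 -> A :=
  triple (v i1 * x i2 - v i2 * x i1) (v i2 * x i0 - v i0 * x i2)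
         (v i0 * x i1 - v i1 * x i0).

Section Cross.
Variables (A : comNzRingType) (v x f : 'I_3 -> A) (F : A) (n : nat).
Hypothesis syz : \sum_i v i * f i = 0.
Hypothesis eul : \sum_i x i * f i = F *+ n.
Let W := cross v x.

(** The triple product expansion (v x x) x f = x (v . f) - v (x . f). *)
Lemma cross_grad (i : 'I_3) :
  cross W f i = - (F *+ n * v i).
Proof.
move: syz eul; rewrite !sum3 => s e; rewrite -e; move: i.
apply: ord3P; rewrite /W /cross /triple !(tnth_nth 0) /=.
- rewrite -[LHS]subr0 -[X in _ - X](mulr0 (x i0)) -s; ring.
- rewrite -[LHS]subr0 -[X in _ - X](mulr0 (x i1)) -s; ring.
- rewrite -[LHS]subr0 -[X in _ - X](mulr0 (x i2)) -s; ring.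
Qed.

(** Along the curve F = 0, W is proportional to the gradient; u is the cross
    product of a and v up to the factor n. *)
Lemma cross_polar (a : 'I_3 -> A) : exists u : 'I_3 -> A,
  forall i, (\sum_j a j * W j) * f i = W i * (\sum_j a j * f j) + u i * F.
Proof.
exists (fun i => n%:R * cross a v i) => i.
have Fv j : n%:R * v j * F = - cross W f j by rewrite cross_grad -mulr_natr; ring.
move: (Fv i0) (Fv i1) (Fv i2); rewrite !sum3.
move: i; apply: ord3P; rewrite /cross /triple !(tnth_nth 0) /= => F0 F1 F2.
- have -> : n%:R * (a i1 * v i2 - a i2 * v i1) * F = a i1 * (n%:R * v i2 * F) - a i2 * (n%:R * v i1 * F) by ring.
  rewrite F1 F2; ring.
- have -> : n%:R * (a i2 * v i0 - a i0 * v i2) * F = a i2 * (n%:R * v i0 * F) - a i0 * (n%:R * v i2 * F) by ring.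
  rewrite F0 F2; ring.
- have -> : n%:R * (a i0 * v i1 - a i1 * v i0) * F = a i0 * (n%:R * v i1 * F) - a i1 * (n%:R * v i0 * F) by ring.
  rewrite F0 F1; ring.
Qed.

Lemma cross_ortho : \sum_i x i * W i = 0.
Proof. by rewrite sum3 /W /cross /triple !(tnth_nth 0) /=; ring. Qed.
End Cross.

(** * The affine chart away from a transverse line *)

Section Chart.
Variables (K : numClosedFieldType) (lam x0 : K).
Implicit Types G : {mpoly K[3]}.

(** The chart x - lam y - x0 z = 1, with affine coordinates v = y and w = z. Its
    line at infinity passes through [lam : 1 : 0]. *)
Definition chart_coords : 'I_3 -> {poly {poly K}} :=
  triple (1 + (x0 *: 'X)%:P + lam%:P *: 'X) 'X 'X%:P.
Definition chart : {mpoly K[3]} -> {poly {poly K}} :=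
  mmap (polyC \o polyC) chart_coords.
HB.instance Definition _ := GRing.RMorphism.on chart.

Definition chart_pt (b c : K) : 'I_3 -> K := triple (1 + lam * c + x0 * b) c b.

Lemma eval2_chart b c G : eval2 b c (chart G) = G.@[chart_pt b c].
Proof.
rewrite (rmorph_mmap (eval2 b c : {rmorphism _ -> _})); apply: eq_mmap => [a|].
  by rewrite /= /eval2 /= /horner_eval !hornerC.
apply: eq_triple; rewrite /= /chart_coords /triple !(tnth_nth 0) /= /eval2 /= /horner_eval.
- by rewrite !hornerE; ring.
- by rewrite !hornerE.
- by rewrite !hornerE.
Qed.

Lemma eval2C b c (a : K) : eval2 b c a%:P%:P = a.
Proof. by rewrite /eval2 /= /horner_eval !hornerC. Qed.

Lemma eval2D b c : {morph @eval2 K b c : u v / u + v}.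
Proof. exact: rmorphD. Qed.

Lemma eval2M b c : {morph @eval2 K b c : u v / u * v}.
Proof. exact: rmorphM. Qed.

Lemma eval2N b c : {morph @eval2 K b c : u / - u}.
Proof. exact: rmorphN. Qed.

Lemma chartD : {morph chart : u v / u + v}.
Proof. exact: rmorphD. Qed.

Lemma chartM : {morph chart : u v / u * v}.
Proof. exact: rmorphM. Qed.

Lemma chartN : {morph chart : u / - u}.
Proof. exact: rmorphN. Qed.

Lemma chartZ a G : chart (a *: G) = a%:P%:P * chart G.
Proof. exact: mmapZ. Qed.

(** At the point w = b, v = c; by the chain rule, the derivatives along w and v
    are x0 G_x + G_z and lam G_x + G_y. *)
Lemma chart_taylor b c G : exists k1 k2,
  [/\ chart G = (G.@[chart_pt b c])%:P%:P + k1 * ('X - b%:P)%:P + k2 * ('X - c%:P%:P),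
      eval2 b c k1 = (x0 *: G^`M(i0) + G^`M(i2)).@[chart_pt b c] &
      eval2 b c k2 = (lam *: G^`M(i0) + G^`M(i1)).@[chart_pt b c]].
Proof.
have [A [GE Ap]] := taylor_mpoly G (chart_pt b c).
exists (x0%:P%:P * chart (A i0) + chart (A i2)).
exists (lam%:P%:P * chart (A i0) + chart (A i1)).
split; last first.
- by rewrite eval2D eval2M eval2C !eval2_chart !Ap mevalD mevalZ.
- by rewrite eval2D eval2M eval2C !eval2_chart !Ap mevalD mevalZ.
rewrite {1}GE sum3 !(chartD, chartM, chartN).
rewrite /chart !mmapC !mmapXU -/chart /chart_coords /chart_pt /triple !(tnth_nth 0) /=.
rewrite !polyCD !polyCM -!mul_polyC !polyCM -!polyC1.
set B := b%:P%:P; set C := c%:P%:P; set X := 'X; set Y := 'X%:P.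
ring.
Qed.
End Chart.

(** Vectors (l y1 + x y2, y1, y2) are tangent to the chart X - l Y - x Z = 1, and
    the two sides are the products in the determinant of H restricted to these
    tangent vectors. If it vanishes, some nonzero tangent vector y is orthogonal
    for H to all tangent vectors, and also to p, which lies in the kernel of H.
    As p is not tangent, y is in the kernel, hence proportional to p: this is
    absurd for a nonzero tangent vector. *)
Lemma chart_hessian_det (K : fieldType) (H : 'I_3 -> 'I_3 -> K) (p : 'I_3 -> K) (l x : K) :
  (forall i j, H i j = H j i) -> (forall i, \sum_k H i k * p k = 0) ->
  p i0 = 1 + l * p i1 + x * p i2 ->
  (forall y, (forall i, \sum_k H i k * y k = 0) -> exists c, forall i, y i = c * p i) ->
  (l * (l * H i0 i0 + H i1 i0) + (l * H i0 i1 + H i1 i1)) *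
  (x * (x * H i0 i0 + H i2 i0) + (x * H i0 i2 + H i2 i2)) !=
  (x * (l * H i0 i0 + H i1 i0) + (l * H i0 i2 + H i1 i2)) *
  (l * (x * H i0 i0 + H i2 i0) + (x * H i0 i1 + H i2 i1)).
Proof.
move=> Hs Hp p0 ker; apply/eqP => det0.
set a := l * _ + _ in det0; set d := x * _ + _ in det0.
set b := x * _ + _ in det0; set b' := l * _ + _ in det0.
have bb : b' = b by rewrite /b /b' (Hs i1 i0) (Hs i2 i0) (Hs i2 i1); ring.
pose ab0 := (a == 0) && (b == 0).
(* A nonzero solution of both equations of the singular 2 x 2 system. *)
pose y1 := if ab0 then 1 else b; pose y2 := if ab0 then 0 else - a.
have e1 : a * y1 + b * y2 = 0.
  rewrite /y1 /y2; case: ifP => [/andP [/eqP -> _]|_]; ring.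
have e2 : b * y1 + d * y2 = 0.
  rewrite /y1 /y2; case: ifP => [/andP [_ /eqP ->]|_]; first by ring.
  by rewrite -(subrr (b * b')) -[X in _ - X]det0 bb; ring.
have y0 : (y1 == 0) && (y2 == 0) = false.
  by rewrite /y1 /y2; case: ifP => [_|]; rewrite ?oner_eq0 // oppr_eq0 andbC.
pose y := triple (l * y1 + x * y2) y1 y2.
pose h i := \sum_k H i k * y k.
have hE i : h i = H i i0 * (l * y1 + x * y2) + H i i1 * y1 + H i i2 * y2.
  by rewrite /h sum3.
have h1 : l * h i0 + h i1 = 0.
  by rewrite -e1 !hE /a /b; ring.
have h2 : x * h i0 + h i2 = 0.
  by rewrite -e2 -bb !hE /b' /d; ring.
have hp : h i0 * p i0 + h i1 * p i1 + h i2 * p i2 = 0.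
  have := Hp i0; have := Hp i1; have := Hp i2; rewrite !sum3 => P2 P1 P0.
  rewrite -[RHS](_ : (l * y1 + x * y2) * 0 + y1 * 0 + y2 * 0 = 0); last by ring.
  by rewrite -{1}P0 -{1}P1 -P2 !hE (Hs i1 i0) (Hs i2 i0) (Hs i2 i1); ring.
have h00 : h i0 = 0.
  rewrite -[RHS]hp p0; have -> : h i1 = - (l * h i0) by apply/eqP; rewrite -addr_eq0 addrC h1.
  have -> : h i2 = - (x * h i0) by apply/eqP; rewrite -addr_eq0 addrC h2.
  ring.
have h10 : h i1 = 0 by move: h1; rewrite h00 mulr0 add0r.
have h20 : h i2 = 0 by move: h2; rewrite h00 mulr0 add0r.
have [c yc] := ker y (ord3P h00 h10 h20).
have c0 : c = 0.
  have := yc i0; rewrite p0 => yE.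
  have: c = y i0 - l * (c * p i1) - x * (c * p i2) by rewrite yE; ring.
  by rewrite -!yc /y /triple !(tnth_nth 0) /= => ->; ring.
have := yc i1; have := yc i2; rewrite c0 !mul0r => y20 y10.
by move: y0; rewrite [y1]y10 [y2]y20 eqxx.
Qed.

Section Singularities.
Variables (K : numClosedFieldType) (n : nat) (F : {mpoly K[3]}).
Variables (V : 'I_3 -> {mpoly K[3]}) (lam x0 : K).

Definition polar := lam *: F^`M(i0) + F^`M(i1).

(** The line X = x Z + lam Y of the pencil through [lam : 1 : 0] is nowhere
    tangent to the curve F = 0: the polar is the derivative of F along these
    lines. Its point [lam : 1 : 0] is left out, because that point will always
    be taken off the curve. *)
Definition transverse x := forall s, F.@[triple (x + lam * s) s 1] = 0 ->
  polar.@[triple (x + lam * s) s 1] != 0.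

(** What is kept of the hypothesis that all singular points are nodes. The
    inclusion of p in the kernel of the Hessian is automatic by homogeneity. *)
Definition hessian_kernel_is_point := forall p : 'I_3 -> K, (exists i, p i != 0) ->
  (forall i, F^`M(i).@[p] = 0) ->
  forall y : 'I_3 -> K, (forall j, \sum_k F^`M(j)^`M(k).@[p] * y k = 0) ->
  exists c, forall i, y i = c * p i.

Hypothesis Fhom : F \is n.-homog.
Hypothesis syz : \sum_i V i * F^`M(i) = 0.
Hypothesis nodes : hessian_kernel_is_point.

Let W := cross V (fun i => 'X_i).

(** Differentiating the syzygy at p, where the gradient vanishes, leaves
    Hess F(p) V(p) = 0, so V(p) is proportional to p. *)
Lemma cross_vanishes p : (exists i, p i != 0) -> (forall i, F^`M(i).@[p] = 0) ->
  forall i, (W i).@[p] = 0.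
Proof.
move=> p0 Fp; have [c Vc] : exists c, forall i, (V i).@[p] = c * p i.
  apply: nodes => // j; have := congr1 (fun G => G^`M(j).@[p]) syz.
  rewrite sum3 !mderivD !mderivM !mevalD !mevalM !Fp !mulr0 !add0r mderiv0 meval0 => e.
  rewrite -[RHS]e.
  by rewrite sum3 ![_^`M(j)^`M(_)]mderiv_comm; ring.
by apply: ord3P; rewrite /W /cross /triple !(tnth_nth 0) /=
  rmorphB !rmorphM /= !mevalXU !Vc; ring.
Qed.

Lemma chart_pt_neq0 b c : exists i, chart_pt lam x0 b c i != 0.
Proof.
have [b0|] := eqVneq b 0; last by exists i2.
have [c0|] := eqVneq c 0; last by exists i1.
by exists i0; rewrite /chart_pt /triple (tnth_nth 0) /= b0 c0 !mulr0 !addr0 oner_eq0.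
Qed.

Lemma hessian_chart_neq0 b c (p := chart_pt lam x0 b c) :
  (forall i, F^`M(i).@[p] = 0) ->
  let G := lam *: F^`M(i0) + F^`M(i1) in let H := x0 *: F^`M(i0) + F^`M(i2) in
  (lam *: G^`M(i0) + G^`M(i1)).@[p] * (x0 *: H^`M(i0) + H^`M(i2)).@[p] !=
  (x0 *: G^`M(i0) + G^`M(i2)).@[p] * (lam *: H^`M(i0) + H^`M(i1)).@[p].
Proof.
move=> Fp; rewrite /= !mderivD !mderivZ !(mevalD, mevalZ).
have hp j : \sum_i p i * F^`M(j)^`M(i).@[p] = 0.
  have := congr1 (meval p) (euler_dhomog (dhomog_mderiv j Fhom)).
  by rewrite mevalMn Fp mul0rn !sum3 !mevalD !mevalM !mevalXU.
apply: (chart_hessian_det (H := fun j k => F^`M(j)^`M(k).@[p]) (p := p)) => //.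
- by move=> i j; rewrite mderiv_comm.
- by move=> j; rewrite -[RHS](hp j); apply: eq_bigr => k _; rewrite mulrC.
- by apply: nodes Fp; apply: chart_pt_neq0.
Qed.
End Singularities.

Lemma top_coef_size (A : comNzRingType) d (x : A) u :
  top_coef d x u -> x != 0 -> size u = d.+1 /\ lead_coef u = x.
Proof.
move=> [ud <-] x0; suff su : size u = d.+1 by rewrite lead_coefE su.
apply/eqP; rewrite eqn_leq ud /= ltnNge; apply: contra x0 => su.
by rewrite nth_default.
Qed.

Lemma subst_lead (K : comNzRingType) d (h : 'I_3 -> {poly {poly K}})
    (v : 'I_3 -> K) (G : {mpoly K[3]}) :
  G \is d.-homog -> G.@[v] != 0 ->
  (forall i, size (h i) <= 2)%N -> (forall i, (h i)`_1 = (v i)%:P) ->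
  size (mmap (polyC \o polyC) h G) = d.+1 /\
  lead_coef (mmap (polyC \o polyC) h G) = (G.@[v])%:P.
Proof.
move=> Ghom G0 h2 hv; apply: top_coef_size; last by rewrite polyC_eq0.
rewrite (rmorph_mmap (polyC : {rmorphism K -> {poly K}})).
rewrite (eq_mmap (k := fun i => (h i)`_1) (g := polyC)) //.
exact: coef_mmap_top.
Qed.

Lemma horner_map_eval2 (K : closedFieldType) (x s : K) (g : {poly {poly K}}) :
  (map_poly (horner_eval x) g).[s] = eval2 x s g.
Proof.
rewrite -[s in LHS](hornerC s x) -[_.[x]]/(horner_eval x s%:P).
by rewrite horner_map.
Qed.

(** * The cross product lies in the Jacobian ideal *)

Section ChartIdeal.
Variables (K : numClosedFieldType) (n : nat) (F : {mpoly K[3]}).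
Variables (V : 'I_3 -> {mpoly K[3]}) (lam x0 x1 : K).

Hypothesis Fhom : F \is n.-homog.
Hypothesis syz : \sum_i V i * F^`M(i) = 0.
Hypothesis n1 : (1 < n)%N.
Hypothesis Flam : F.@[triple lam 1 0] != 0.
Hypothesis tr1 : transverse F lam x1.
Hypothesis x01 : x0 != x1.
Hypothesis nodes : hessian_kernel_is_point F.

Let W := cross V (fun i => 'X_i).
Local Notation chart := (chart lam x0).

Definition jacobian_ideal (u : {poly {poly K}}) :=
  exists k : 'I_3 -> {poly {poly K}}, u = \sum_i k i * chart F^`M(i).

Lemma jacobian_idealP : is_ideal jacobian_ideal.
Proof.
split=> [u v [k ->] [l ->]|a v [k ->]].
  by exists (fun i => k i + l i); rewrite -big_split; apply: eq_bigr => i _; rewrite mulrDl.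
by exists (fun i => a * k i); rewrite mulr_sumr; apply: eq_bigr => i _; rewrite mulrA.
Qed.

Lemma jacobian_ideal_grad i : jacobian_ideal (chart F^`M(i)).
Proof.
exists (fun j => (i == j)%:R); rewrite (bigD1 i) //= eqxx mul1r big1 ?addr0 // => j.
by rewrite eq_sym => /negbTE ->; rewrite mul0r.
Qed.

Lemma jacobian_ideal_F : jacobian_ideal (chart F).
Proof.
exists (fun i => (n%:R^-1)%:P%:P * chart 'X_i).
rewrite (eq_bigr (fun i => n%:R^-1%:P%:P * chart ('X_i * F^`M(i)))).
  rewrite -mulr_sumr -(raddf_sum chart) (euler_dhomog Fhom) -chartZ -scaler_nat scalerA.
  by rewrite mulVf ?scale1r // pnatr_eq0 -lt0n (ltn_trans _ n1).
by move=> i _; rewrite chartM mulrA.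
Qed.

(** At a nonsingular point some partial derivative does not vanish. At a
    singular point, the derivatives of F along v and w vanish, and so does W j,
    so all three are combinations of v - c and w - b. Solving for v - c and w - b
    by Cramer's rule multiplies by the determinant g of the coefficients, whose
    value at the point is the Hessian determinant of the dehomogenized curve. *)
Lemma jacobian_ideal_local b c j :
  exists2 g, jacobian_ideal (g * chart (W j)) & eval2 b c g != 0.
Proof.
have [JD JM] := jacobian_idealP.
pose p := chart_pt lam x0 b c.
have [/existsP [i Fi]|] := boolP [exists i, F^`M(i).@[p] != 0].
  exists (chart F^`M(i)); last by rewrite eval2_chart.
  by rewrite mulrC; apply: (JM); apply: jacobian_ideal_grad.
rewrite negb_exists => /forallP /= Fp'.
have {Fp'} Fp i : F^`M(i).@[p] = 0 by apply/eqP; have := Fp' i; rewrite negbK.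
have det := hessian_chart_neq0 Fhom nodes Fp.
have Wp := cross_vanishes syz nodes (chart_pt_neq0 lam x0 b c) Fp j.
pose Fv := lam *: F^`M(i0) + F^`M(i1); pose Fw := x0 *: F^`M(i0) + F^`M(i2).
have [k1 [k2 [FvE Ek1 Ek2]]] := chart_taylor lam x0 b c Fv.
have [l1 [l2 [FwE El1 El2]]] := chart_taylor lam x0 b c Fw.
have [e1 [e2 [WE _ _]]] := chart_taylor lam x0 b c (W j).
have Fvp : Fv.@[p] = 0 by rewrite mevalD mevalZ !Fp mulr0 addr0.
have Fwp : Fw.@[p] = 0 by rewrite mevalD mevalZ !Fp mulr0 addr0.
rewrite Fvp !polyC0 add0r in FvE; rewrite Fwp !polyC0 add0r in FwE.
rewrite Wp !polyC0 add0r in WE.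
have JFv : jacobian_ideal (chart Fv).
  rewrite chartD chartZ; apply: (JD); last exact: jacobian_ideal_grad.
  exact/JM/jacobian_ideal_grad.
have JFw : jacobian_ideal (chart Fw).
  rewrite chartD chartZ; apply: (JD); last exact: jacobian_ideal_grad.
  exact/JM/jacobian_ideal_grad.
exists (k2 * l1 - k1 * l2).
  have -> : (k2 * l1 - k1 * l2) * chart (W j) =
      (e2 * l1 - e1 * l2) * chart Fv + (e1 * k2 - e2 * k1) * chart Fw.
    by rewrite WE FvE FwE; ring.
  by apply: (JD); apply: (JM).
by rewrite eval2D eval2N !eval2M Ek1 Ek2 El1 El2 subr_eq0.
Qed.

Lemma polar_dhomog : polar F lam \is n.-1.-homog.
Proof. by rewrite rpredD ?rpredZ ?dhomog_mderiv. Qed.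

Lemma polar_lam : (polar F lam).@[triple lam 1 0] = F.@[triple lam 1 0] *+ n.
Proof.
have := congr1 (meval (triple lam 1 0)) (euler_dhomog Fhom).
rewrite mevalMn sum3 !mevalD !mevalM !mevalXU mevalZ => <-.
by rewrite /triple !(tnth_nth 0) /=; ring.
Qed.

Lemma polar_lam_neq0 : (polar F lam).@[triple lam 1 0] != 0.
Proof. by rewrite polar_lam mulrn_eq0 negb_or Flam -lt0n (ltn_trans _ n1). Qed.

Lemma chart_top d (G : {mpoly K[3]}) : G \is d.-homog -> G.@[triple lam 1 0] != 0 ->
  size (chart G) = d.+1 /\ lead_coef (chart G) = (G.@[triple lam 1 0])%:P.
Proof.
move=> Ghom G0; apply: subst_lead => //; apply: ord3P;
  rewrite /chart_coords /triple !(tnth_nth 0) /=.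
- apply: leq_trans (size_polyD _ _) _; rewrite geq_max -polyC1 -polyCD.
  rewrite (leq_trans (size_polyC_leq1 _)) //.
  by rewrite (leq_trans (size_scale_leq _ _)) // size_polyX.
- by rewrite size_polyX.
- by rewrite size_polyC; case: eqP.
- by rewrite !coefD coef1 coefC coefZ coefX mulr1 !add0r.
- by rewrite coefX.
- by rewrite coefC.
Qed.

(** The value of the resultant at w is, up to homogeneity, the one on the line of
    the pencil that meets the chart at that w: the line with parameter x1
    corresponds to w = (x1 - x0)^-1, and it is transverse. *)
Lemma chart_resultant_neq0 : resultant (chart F) (chart (polar F lam)) != 0.
Proof.
have [sF lF] := chart_top Fhom Flam.
have [sP lP] := chart_top polar_dhomog polar_lam_neq0.
have x10 : x1 - x0 != 0 by rewrite subr_eq0 eq_sym.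
pose w := (x1 - x0)^-1; have w0 : w != 0 by rewrite invr_neq0.
suff : horner_eval w (resultant (chart F) (chart (polar F lam))) != 0.
  by apply: contraNneq => ->; rewrite rmorph0.
rewrite map_resultant ?lF ?lP /= /horner_eval ?hornerC ?polar_lam_neq0 //.
rewrite resultant_eq0 -leqNgt -/(horner_eval w).
suff /eqP -> : coprimep (map_poly (horner_eval w) (chart F)) (map_poly (horner_eval w) (chart (polar F lam))) by [].
have ev G z : (map_poly (horner_eval w) (chart G)).[z] = G.@[chart_pt lam x0 w z].
  by rewrite horner_map_eval2 eval2_chart.
have pt G d z : G \is d.-homog -> G.@[chart_pt lam x0 w z] =
    w ^+ d * G.@[triple (x1 + lam * (z / w)) (z / w) 1].
  move=> Ghom; rewrite -(meval_dhomogZ _ _ Ghom); apply: meval_eq => i.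
  rewrite /chart_pt; apply/esym; move: i; apply: eq_triple; rewrite /triple !(tnth_nth 0) /=.
  - transitivity (w * (x1 - x0) + lam * (z / w * w) + x0 * w); first by ring.
    by rewrite divfK // mulVf.
  - by rewrite mulrC divfK.
  - by rewrite mulr1.
apply/Pdiv.ClosedField.coprimepP => z.
rewrite rootE !ev (pt _ _ _ Fhom) (pt _ _ _ polar_dhomog) mulf_eq0 expf_eq0 (negbTE w0) andbF /=.
by move=> /eqP /tr1 Pz; rewrite mulf_neq0 // expf_neq0.
Qed.

(** The Nullstellensatz is applied to the ideal of all g such that g W_j belongs
    to the Jacobian ideal. *)
Lemma cross_in_jacobian_ideal j : jacobian_ideal (chart (W j)).
Proof.
have [JD JM] := jacobian_idealP.
have [sF lF] := chart_top Fhom Flam.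
have [sP lP] := chart_top polar_dhomog polar_lam_neq0.
pose I g := jacobian_ideal (g * chart (W j)).
have Iid : is_ideal I.
  split=> [u v Iu Iv|a v Iv]; rewrite /I ?mulrDl -?mulrA; first exact: JD.
  exact: JM.
have JI g : jacobian_ideal g -> I g by move=> Jg; rewrite /I mulrC; apply: (JM).
rewrite -[chart _]mul1r -/(I 1).
apply: (nullstellensatz2 Iid _ chart_resultant_neq0 (JI _ jacobian_ideal_F) lF Flam).
  have [] := @resultant_in_ideal _ (chart F) (chart (polar F lam)).
  - by rewrite sF ltnS (ltn_trans _ n1).
  - by rewrite sP prednK // (ltn_trans _ n1).
  move=> [u v] /= _ ->; apply: JI; apply: (JD); apply: (JM).
    exact: jacobian_ideal_F.
  rewrite chartD chartZ; apply: (JD); last exact: jacobian_ideal_grad.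
  exact/JM/jacobian_ideal_grad.
by move=> b c; apply: jacobian_ideal_local.
Qed.
End ChartIdeal.

(** * Leading coefficients on the line at infinity *)

Section BlowupChart.
Variables (K : numClosedFieldType) (lam x0 : K).
Implicit Types G : {mpoly K[3]}.

Definition blowup_chart : {mpoly K[3]} -> {poly {poly K}} := blowup (K := K) \o chart lam x0.
HB.instance Definition _ := GRing.RMorphism.on blowup_chart.

Definition blowup_coords : 'I_3 -> {poly {poly K}} :=
  triple (1 + (x0%:P + lam *: 'X) *: 'X) ('X *: 'X) 'X.

Lemma blowup_chartE G : blowup_chart G = mmap (polyC \o polyC) blowup_coords G.
Proof.
rewrite /blowup_chart /= (rmorph_mmap (@blowup K : {rmorphism _ -> _})).
apply: eq_mmap => [a|]; first by rewrite /= blowupC map_polyC.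
apply: ord3P; rewrite /= /chart_coords /blowup_coords /triple !(tnth_nth 0) /=.
- rewrite -[LHS]/(blowup _) -(mul_polyC lam%:P) -polyC1 !(blowupD, blowupM, blowupC) blowupX.
  rewrite !map_polyC /= map_polyZ map_polyX -addrA scalerDl; congr (1 + (_ + _)).
  by rewrite mul_polyC scalerA mul_polyC.
- exact: blowupX.
- by rewrite -[LHS]/(blowup _) blowupC map_polyX.
Qed.

Lemma blowup_chartM : {morph blowup_chart : u v / u * v}.
Proof. exact: rmorphM. Qed.

Lemma blowup_chartD : {morph blowup_chart : u v / u + v}.
Proof. exact: rmorphD. Qed.

Lemma blowup_chartXU i : blowup_chart 'X_i = blowup_coords i.
Proof. by rewrite blowup_chartE mmapXU. Qed.

(** The restriction to the line at infinity of the chart, parametrized by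
    s -> [x0 + lam s : s : 1]; the remaining point of the line is [lam : 1 : 0]. *)
Definition line_form : {mpoly K[3]} -> {poly K} :=
  mmap polyC (triple (x0%:P + lam *: 'X) 'X 1).

Lemma horner_line_form G s : (line_form G).[s] = G.@[triple (x0 + lam * s) s 1].
Proof.
rewrite -[LHS]/(horner_eval s (line_form G)) rmorph_mmap.
apply: eq_mmap => [a|]; first by rewrite /= /horner_eval hornerC.
by apply: ord3P; rewrite /triple /= !(tnth_nth 0) /= /horner_eval !hornerE.
Qed.

Lemma line_form_top d G : G \is d.-homog -> top_coef d G.@[triple lam 1 0] (line_form G).
Proof.
move=> Ghom; rewrite /line_form (eq_mmap (g := polyC \o idfun) (k := triple (x0%:P + lam *: 'X) 'X 1)) //.
rewrite /meval (eq_mmap (g := idfun) (k := fun i => (triple (x0%:P + lam *: 'X) 'X 1 i)`_1)) //.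
  apply: coef_mmap_top Ghom; apply: ord3P; rewrite /triple !(tnth_nth 0) /=.
  - rewrite (leq_trans (size_polyD _ _)) // geq_max (leq_trans (size_polyC_leq1 _)) //.
    by rewrite (leq_trans (size_scale_leq _ _)) // size_polyX.
  - by rewrite size_polyX.
  - by rewrite size_poly1.
apply: ord3P; rewrite /triple !(tnth_nth 0) /=.
- by rewrite coefD coefC coefZ coefX mulr1 add0r.
- by rewrite coefX.
- by rewrite coef1.
Qed.

Lemma blowup_chart_top d G : G \is d.-homog -> top_coef d (line_form G) (blowup_chart G).
Proof.
move=> Ghom; rewrite blowup_chartE /line_form.
rewrite (eq_mmap (g := polyC) (k := fun i => (blowup_coords i)`_1)) //.
  apply: coef_mmap_top Ghom; apply: ord3P; rewrite /blowup_coords /triple !(tnth_nth 0) /=.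
  - rewrite (leq_trans (size_polyD _ _)) // geq_max size_poly1.
    by rewrite (leq_trans (size_scale_leq _ _)) // size_polyX.
  - by rewrite (leq_trans (size_scale_leq _ _)) // size_polyX.
  - by rewrite size_polyX.
apply: ord3P; rewrite /blowup_coords /triple !(tnth_nth 0) /=.
- by rewrite coefD coef1 coefZ coefX mulr1 add0r.
- by rewrite coefZ coefX mulr1.
- by rewrite coefX.
Qed.

(** The substitution parametrizes the points outside the lines
    x - lam y - x0 z = 0 and z = 0 up to a scalar, so G vanishes outside them. *)
Lemma blowup_chart_inj d G : G \is d.-homog -> blowup_chart G = 0 -> G = 0.
Proof.
move=> Ghom G0; pose ell : {mpoly K[3]} := 'X_i0 - lam *: 'X_i1 - x0 *: 'X_i2.
have ellE p : ell.@[p] = p i0 - lam * p i1 - x0 * p i2.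
  by rewrite !mevalB !mevalZ !mevalXU.
suff : ell * 'X_i2 * G = 0.
  move=> /eqP; rewrite !mulf_eq0 => /orP [/orP [/eqP e|/eqP e]|/eqP //].
    have := congr1 (meval (triple 1 0 0)) e.
    by rewrite ellE meval0 /triple !(tnth_nth 0) /= !mulr0 !subr0 => /eqP; rewrite oner_eq0.
  have := congr1 (meval (fun=> 1)) e.
  by rewrite mevalXU meval0 => /eqP; rewrite oner_eq0.
apply: mpoly_eq0_points => p; rewrite !mevalM mevalXU.
have [->|l0] := eqVneq ell.@[p] 0; first by rewrite !mul0r.
have [->|p2] := eqVneq (p i2) 0; first by rewrite mulr0 mul0r.
set l := ell.@[p] in l0 *.
have lE : p i0 = l + lam * p i1 + x0 * p i2 by rewrite /l ellE; ring.
have := congr1 (eval2 (p i1 / p i2) (p i2 / l)) G0.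
rewrite blowup_chartE rmorph0 (rmorph_mmap (eval2 _ _ : {rmorphism _ -> _})).
rewrite (eq_mmap (g := idfun) (k := fun i => l^-1 * p i)).
- rewrite -/(meval _ G) (meval_dhomogZ _ _ Ghom) => /eqP.
  by rewrite mulf_eq0 expf_eq0 invr_eq0 (negbTE l0) andbF => /eqP ->; rewrite mulr0.
- exact: eval2C.
apply: ord3P; rewrite /= /blowup_coords /triple !(tnth_nth 0) /= /eval2 /= /horner_eval !hornerE /=.
- by rewrite lE; field; rewrite ?l0 ?p2.
- by field; rewrite ?l0 ?p2.
- by rewrite mulrC.
Qed.
End BlowupChart.

(** * Nodal curves have no syzygy of low degree *)

Lemma rmorph_cross (A B : comNzRingType) (f : {rmorphism A -> B}) v x i :
  f (cross v x i) = cross (f \o v) (f \o x) i.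
Proof.
by move: i; apply: ord3P; rewrite /cross /triple !(tnth_nth 0) /= rmorphB !rmorphM.
Qed.

(** The leading coefficient of f divides the one of w, whose degree in s is at
    most the degree of w in t. *)
Lemma graded_syzygy_eq0 (K : closedFieldType) (f g u w : {poly {poly K}}) :
  graded w -> coprimep (lead_coef f) (lead_coef g) ->
  (size w < size (lead_coef f))%N -> w * g = u * f -> w = 0.
Proof.
move=> gw cop lt /(congr1 lead_coef); rewrite !lead_coefM => e.
apply/eqP; apply: contraT => w0; move: lt; rewrite ltnNge => /negP []; rewrite -lead_coef_eq0 in w0.
have /dvdp_leq le : lead_coef f %| lead_coef w.
  by rewrite -(Gauss_dvdpl _ cop) e dvdp_mull.
apply: leq_trans (le w0) _; apply: leq_trans (gw _) _.
by rewrite prednK // size_poly_gt0 -lead_coef_eq0.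
Qed.

Lemma mul_self_comb_eq0 (A : idomainType) (l w0 w1 wa : A) :
  wa = l * w0 + w1 -> w0 * wa = 0 -> w1 * wa = 0 -> wa = 0.
Proof.
move=> e e0 e1; apply/eqP; rewrite -[_ == 0]orbb -mulf_eq0 {1}e mulrDl -mulrA e0 e1.
by rewrite mulr0 addr0.
Qed.

Lemma cross_eq0 (A : comNzRingType) (w f : 'I_3 -> A) :
  (forall i, w i = 0) -> forall i, cross w f i = 0.
Proof.
by move=> w0; apply: ord3P; rewrite /cross /triple !(tnth_nth 0) /= !w0; ring.
Qed.

Lemma proportional_orthogonal (A : comNzRingType) (x0 x1 x2 w0 w1 w2 b0 b1 b2 q p : A) :
  x0 * w0 + x1 * w1 + x2 * w2 = 0 ->
  w0 * q = b0 * p -> w1 * q = b1 * p -> w2 * q = b2 * p ->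
  (x0 * b0 + x1 * b1 + x2 * b2) * p = 0.
Proof.
move=> o e0 e1 e2; rewrite !mulrDl -!mulrA -e0 -e1 -e2 -[RHS](mul0r q) -o; ring.
Qed.

Section LowDegreeSyzygy.
Variables (K : numClosedFieldType) (n m : nat) (F : {mpoly K[3]}).
Variables (V : 'I_3 -> {mpoly K[3]}) (lam x0 x1 : K).

Hypothesis Fhom : F \is n.-homog.
Hypothesis Vhom : forall i, V i \is m.-homog.
Hypothesis syz : \sum_i V i * F^`M(i) = 0.
Hypothesis nm : (2 * m.+1 < n)%N.
Hypothesis Flam : F.@[triple lam 1 0] != 0.
Hypothesis tr0 : transverse F lam x0.
Hypothesis tr1 : transverse F lam x1.
Hypothesis x01 : x0 != x1.
Hypothesis nodes : hessian_kernel_is_point F.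

Let W := cross V (fun i => 'X_i).
Local Notation Phi := (blowup_chart lam x0).

Lemma cross_dhomog i : W i \is m.+1.-homog.
Proof.
have VX k l : V k * 'X_l \is m.+1.-homog by rewrite -[m.+1]addn1 dhomogM ?dhomogXU.
by move: i; apply: ord3P; rewrite /W /cross /triple !(tnth_nth 0) /=; apply: rpredB; exact: VX.
Qed.

Let n1 : (1 < n)%N. Proof. by lia. Qed.

(** The computation takes place in K[s][t], where the W_j are seen through the
    substitution Phi. *)
Lemma low_degree_syzygy_eq0 i : V i = 0.
Proof.
pose a : 'I_3 -> K := triple lam 1 0.
pose Pa := polar F lam; pose Wa := lam *: W i0 + W i1.
have Pahom : Pa \is n.-1.-homog := polar_dhomog lam Fhom.
have Wahom : Wa \is m.+1.-homog.
  by apply: rpredD; [apply: rpredZ|]; exact: cross_dhomog.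
have Palam : Pa.@[a] != 0 := polar_lam_neq0 Fhom n1 Flam.
have [slF llF] := top_coef_size (line_form_top lam x0 Fhom) Flam.
have [slP llP] := top_coef_size (line_form_top lam x0 Pahom) Palam.
have lF0 : line_form lam x0 F != 0 by rewrite -size_poly_eq0 slF.
have lP0 : line_form lam x0 Pa != 0 by rewrite -size_poly_eq0 slP.
have [sF lF] := top_coef_size (blowup_chart_top lam x0 Fhom) lF0.
have [sP lP] := top_coef_size (blowup_chart_top lam x0 Pahom) lP0.
have F0 : Phi F != 0 by rewrite -size_poly_eq0 sF.
have P0 : Phi Pa != 0 by rewrite -size_poly_eq0 sP.
have cop : coprimep (line_form lam x0 F) (line_form lam x0 Pa).
  apply/Pdiv.ClosedField.coprimepP => s; rewrite rootE !horner_line_form => /eqP.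
  exact: tr0.
have n0 : (0 < n)%N by exact: ltn_trans n1.
have n1E : n.-1.+1 = n by rewrite prednK.
have gr G : graded (Phi G) by exact: blowup_graded.
have Phi0 : Phi 0 = 0 by exact: rmorph0.
have PW j : Phi (W j) = cross (Phi \o V) (fun i => Phi 'X_i) j by exact: rmorph_cross.
have syzP : \sum_i Phi (V i) * Phi F^`M(i) = 0.
  by have := congr1 Phi syz; rewrite !sum3 !blowup_chartD !blowup_chartM Phi0.
have eulP : \sum_i Phi 'X_i * Phi F^`M(i) = Phi F *+ n.
  by have := congr1 Phi (euler_dhomog Fhom); rewrite !sum3 !blowup_chartD !blowup_chartM raddfMn.
have [u cp] : exists u : 'I_3 -> {mpoly K[3]}, forall i, Wa * F^`M(i) = W i * Pa + u i * F.
  have [u uE] := cross_polar syz (euler_dhomog Fhom) (triple lam%:MP 1 0).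
  exists u => j; have := uE j; rewrite !sum3 /triple !(tnth_nth 0) /=.
  by rewrite !mul1r !mul0r !addr0 /Wa /Pa /polar -!mul_mpolyC.
have key j : exists b : K, Phi (W j) * Phi Wa = b%:P%:P * Phi Pa.
  have [k Wk] := cross_in_jacobian_ideal Fhom syz n1 Flam tr1 x01 nodes j.
  (* Multiply W_j = sum k_i F_i by W_a, and replace W_a F_i by W_i F_a mod F. *)
  have ch : chart lam x0 (W j) * chart lam x0 Wa =
     (\sum_i k i * chart lam x0 (u i)) * chart lam x0 F +
     (\sum_i k i * chart lam x0 (W i)) * chart lam x0 Pa.
    rewrite Wk !mulr_suml -big_split; apply: eq_bigr => i' _ /=.
    by rewrite -mulrA -chartM mulrC [F^`M(i') * _]mulrC cp chartD !chartM; ring.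
  have := congr1 (@blowup K) ch.
  rewrite !(rmorphD (@blowup K)) !(rmorphM (@blowup K)).
  move=> chP; have e : Phi (W j) * Phi Wa =
      blowup (\sum_i k i * chart lam x0 (u i)) * Phi F +
      blowup (\sum_i k i * chart lam x0 (W i)) * Phi Pa by exact: chP.
  rewrite e; apply: (@graded_lead_eliminate _ n) => //; try exact: blowup_graded.
  - by rewrite sP.
  - by rewrite lP slP.
  - by rewrite lF lP.
  rewrite -e -blowup_chartM.
  have [le _] := blowup_chart_top lam x0 (dhomogM (cross_dhomog j) Wahom).
  by apply: leq_trans le _; rewrite addnn -mul2n.
have [b0 B0] := key i0; have [b1 B1] := key i1; have [b2 B2] := key i2.
have ortho : (blowup_coords lam x0 i0 * b0%:P%:P + blowup_coords lam x0 i1 * b1%:P%:P + blowup_coords lam x0 i2 * b2%:P%:P) * Phi Pa = 0.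
  have o : Phi 'X_i0 * Phi (W i0) + Phi 'X_i1 * Phi (W i1) + Phi 'X_i2 * Phi (W i2) = 0.
    by rewrite !PW -[RHS](cross_ortho (Phi \o V) (fun i => Phi 'X_i)) sum3.
  rewrite -!blowup_chartXU; exact: proportional_orthogonal o B0 B1 B2.
have {ortho} ortho := mulIf P0 (etrans ortho (esym (mul0r _))).
(* Evaluating X . b = 0 at three points separates the coordinates of b. *)
have e s t : (1 + (x0 + lam * s) * t) * b0 + s * t * b1 + t * b2 = 0.
  have := congr1 (eval2 s t) ortho.
  rewrite /blowup_coords /triple !(tnth_nth 0) /= !eval2D !eval2M !eval2C.
  by rewrite /eval2 /= /horner_eval !hornerE.
have b00 : b0 = 0 by rewrite -(e 0 0); ring.
have b20 : b2 = 0 by rewrite -(e 0 1) b00; ring.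
have b10 : b1 = 0 by rewrite -(e 1 1) b00 b20; ring.
have WaE : Phi Wa = Phi lam%:MP * Phi (W i0) + Phi (W i1).
  by rewrite -blowup_chartM -blowup_chartD mul_mpolyC.
have PWa0 : Phi Wa = 0.
  apply: mul_self_comb_eq0 WaE _ _; first by rewrite B0 b00 !polyC0 mul0r.
  by rewrite B1 b10 !polyC0 mul0r.
have cop' : coprimep (lead_coef (Phi F)) (lead_coef (Phi Pa)) by rewrite lF lP.
have PW0 j : Phi (W j) = 0.
  have sW : (size (Phi (W j)) < size (lead_coef (Phi F)))%N.
    rewrite lF slF; have [sW _] := blowup_chart_top lam x0 (cross_dhomog j).
    apply: leq_ltn_trans sW _; rewrite ltnS; apply: leq_trans nm; rewrite mul2n -addnn.
    by rewrite -addSn leq_addr.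
  have e1 : Phi (W j) * Phi Pa + Phi (u j) * Phi F = 0.
    by rewrite -2!blowup_chartM -blowup_chartD -cp blowup_chartM PWa0 mul0r.
  have e2 : Phi (W j) * Phi Pa = - Phi (u j) * Phi F.
    by apply/eqP; rewrite mulNr -addr_eq0; apply/eqP.
  exact: (graded_syzygy_eq0 (gr (W j)) cop' sW e2).
apply: (blowup_chart_inj (lam := lam) (x0 := x0) (Vhom i)).
have := cross_grad syzP eulP i.
have -> : cross (cross (Phi \o V) (fun i => Phi 'X_i)) (fun i => Phi F^`M(i)) i = 0.
  by apply: cross_eq0 => k; rewrite -PW PW0.
move/esym/eqP; rewrite oppr_eq0 mulf_eq0 -mulr_natr mulf_eq0 (negbTE F0) /=.
have -> : (n%:R == 0 :> {poly {poly K}}) = false.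
  by rewrite -!polyC_natr !polyC_eq0 pnatr_eq0 -[n == _]negbK -lt0n n0.
by move=> /eqP.
Qed.
End LowDegreeSyzygy.

(** * Existence of transverse lines *)

(** Gauss's lemma over K[x]: a linear factor x - z of c divides q d, so modulo
    x - z one of q and d vanishes, and the factor can be cancelled from it. *)
Lemma gauss_factor (K : closedFieldType) (c : {poly K}) (p q d : {poly {poly K}}) :
  c != 0 -> c *: p = q * d ->
  exists q' d', [/\ p = q' * d', size q' = size q & size d' = size d].
Proof.
have div z (g : {poly {poly K}}) : map_poly (horner_eval z) g = 0 ->
    exists2 k, g = ('X - z%:P) *: k & size k = size g.
  move=> g0; have [k gE] := eval_coef_taylor z g; exists k.
    by rewrite {1}gE (map_poly_comp polyC (horner_eval z)) g0 rmorph0 add0r mulrC mul_polyC.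
  rewrite [in RHS]gE (map_poly_comp polyC (horner_eval z)) g0 rmorph0 add0r mulrC mul_polyC.
  by rewrite size_scale // polyXsubC_eq0.
have [N] := ubnP (size c); elim: N => // N IH in c q d * => cN c0 cE.
have [/eqP sc|/closed_rootP [z cz]] := boolP (size c == 1)%N.
  have cC : c = (c`_0)%:P by apply: size1_polyC; rewrite sc.
  have a0 : c`_0 != 0 by rewrite -polyC_eq0 -cC.
  exists (((c`_0)^-1)%:P *: q), d; rewrite size_scale ?polyC_eq0 ?invr_eq0 //; split=> //.
  by rewrite -scalerAl -cE scalerA {2}cC -polyCM mulVf // polyC1 scale1r.
have /factor_theorem [c' c'E] := cz.
have c'0 : c' != 0 by apply: contraNneq c0 => c'0; rewrite c'E c'0 mul0r.
have sc' : (size c' < N)%N.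
  by move: cN; rewrite c'E size_mul ?polyXsubC_eq0 // size_XsubC addn2.
have xz0 : ('X - z%:P)%:P != 0 :> {poly {poly K}} by rewrite polyC_eq0 polyXsubC_eq0.
have : map_poly (horner_eval z) q * map_poly (horner_eval z) d = 0.
  rewrite -rmorphM -cE -mul_polyC rmorphM /= map_polyC /= /horner_eval.
  by rewrite (rootP cz) polyC0 mul0r.
move/eqP; rewrite mulf_eq0 => /orP [] /eqP /div [k kE sk].
  have [|q' [d' [pE sq sd]]] := IH c' k d sc' c'0.
    by apply: (mulfI xz0); rewrite !mul_polyC scalerA mulrC -c'E cE kE scalerAl.
  by exists q', d'; rewrite sq sk.
have [|q' [d' [pE sq sd]]] := IH c' q k sc' c'0.
  by apply: (mulfI xz0); rewrite !mul_polyC scalerA mulrC -c'E cE kE scalerAr.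
by exists q', d'; rewrite sd sk.
Qed.

Section Pencil.
Variables (K : numClosedFieldType) (lam : K).

(** The parallel lines x -> (x + lam y, y) in the direction (lam, 1), in the
    chart z = 1; y is the outer variable of K[x][y]. *)
Definition pencil_coords : 'I_3 -> {poly {poly K}} := triple ('X%:P + lam%:P *: 'X) 'X 1.
Definition pencil : {mpoly K[3]} -> {poly {poly K}} := mmap (polyC \o polyC) pencil_coords.

Definition shear : {mpoly K[2]} -> {poly {poly K}} :=
  mmap (polyC \o polyC) (fun k => pencil_coords (widen_ord (leqnSn 2) k)).
HB.instance Definition _ := GRing.RMorphism.on shear.

(** [unshear] is the inverse of [shear]; it carries a factorization in K[x][y]
    back to the given coordinates, where f is known to be irreducible. *)
Definition unshear_coef : {poly K} -> {mpoly K[2]} :=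
  horner_eval ('X_ord0 - lam *: 'X_ord_max) \o map_poly (@mpolyC 2 K).
HB.instance Definition _ := GRing.RMorphism.on unshear_coef.
Definition unshear : {poly {poly K}} -> {mpoly K[2]} :=
  horner_eval 'X_ord_max \o map_poly unshear_coef.
HB.instance Definition _ := GRing.RMorphism.on unshear.

Lemma unshearC c : unshear c%:P = unshear_coef c.
Proof. by rewrite /unshear /= map_polyC /= /horner_eval hornerC. Qed.
Lemma unshearX : unshear 'X = 'X_ord_max.
Proof. by rewrite /unshear /= map_polyX /= /horner_eval hornerX. Qed.
Lemma unshearD : {morph unshear : u v / u + v}.
Proof. exact: rmorphD. Qed.
Lemma unshearM : {morph unshear : u v / u * v}.
Proof. exact: rmorphM. Qed.
Lemma unshear_coefC c : unshear_coef c%:P = c%:MP.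
Proof. by rewrite /unshear_coef /= map_polyC /= /horner_eval hornerC. Qed.
Lemma unshear_coefX : unshear_coef 'X = 'X_ord0 - lam *: 'X_ord_max.
Proof. by rewrite /unshear_coef /= map_polyX /= /horner_eval hornerX. Qed.
Lemma unshear_coefD : {morph unshear_coef : u v / u + v}.
Proof. exact: rmorphD. Qed.
Lemma unshear_coefM : {morph unshear_coef : u v / u * v}.
Proof. exact: rmorphM. Qed.
Lemma shearC c : shear c%:MP = c%:P%:P.
Proof. by rewrite /shear mmapC. Qed.
Lemma shearD : {morph shear : u v / u + v}.
Proof. exact: rmorphD. Qed.
Lemma shearN : {morph shear : u / - u}.
Proof. exact: rmorphN. Qed.
Lemma shearM : {morph shear : u v / u * v}.
Proof. exact: rmorphM. Qed.
Lemma shearX0 : shear 'X_ord0 = 'X%:P + lam%:P *: 'X.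
Proof. by rewrite /shear mmapXU /pencil_coords /triple (tnth_nth 0). Qed.
Lemma shearX1 : shear 'X_ord_max = 'X.
Proof. by rewrite /shear mmapXU /pencil_coords /triple (tnth_nth 0). Qed.

Lemma ord2P (P : 'I_2 -> Prop) : P ord0 -> P ord_max -> forall i, P i.
Proof.
move=> P0 P1 [[|[|//]] h].
- by rewrite (_ : Ordinal h = ord0) //; apply: val_inj.
- by rewrite (_ : Ordinal h = ord_max) //; apply: val_inj.
Qed.

Lemma shearK : cancel shear unshear.
Proof.
move=> p; apply: (eq_rmorph_mpoly (f := unshear \o shear) (g := idfun)) p.
  by move=> c; rewrite /= shearC unshearC unshear_coefC.
apply: ord2P; rewrite /= ?shearX0 ?shearX1 ?unshearX //.
by rewrite unshearD unshearC unshear_coefX -mul_polyC unshearM unshearC unshear_coefC unshearX mul_mpolyC subrK.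
Qed.

Lemma unshearK : cancel unshear shear.
Proof.
have unshear_coefK c : shear (unshear_coef c) = c%:P.
  elim/poly_ind: c => [|c a IH]; first by rewrite -polyC0 unshear_coefC shearC.
  rewrite unshear_coefD unshear_coefM shearD shearM IH unshear_coefX unshear_coefC shearC.
  rewrite shearD shearN -mul_mpolyC shearM shearC shearX0 shearX1 -mul_polyC addrK.
  by rewrite -polyCM -polyCD.
move=> g; elim/poly_ind: g => [|g c IH].
  by rewrite -polyC0 unshearC unshear_coefK.
by rewrite unshearD unshearM shearD shearM IH unshearX shearX1 unshearC unshear_coefK.
Qed.

Lemma pencil_top d G : G \is d.-homog -> G.@[triple lam 1 0] != 0 ->
  size (pencil G) = d.+1 /\ lead_coef (pencil G) = (G.@[triple lam 1 0])%:P.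
Proof.
move=> Ghom G0; apply: subst_lead => //; apply: ord3P;
  rewrite /pencil_coords /triple !(tnth_nth 0) /=.
- apply: leq_trans (size_polyD _ _) _; rewrite geq_max (leq_trans (size_polyC_leq1 _)) //.
  by rewrite (leq_trans (size_scale_leq _ _)) // size_polyX.
- by rewrite size_polyX.
- by rewrite size_poly1.
- by rewrite coefD coefC coefZ coefX mulr1 add0r.
- by rewrite coefX.
- by rewrite coef1.
Qed.

Lemma horner_pencil G x s :
  (map_poly (horner_eval x) (pencil G)).[s] = G.@[triple (x + lam * s) s 1].
Proof.
rewrite horner_map_eval2 /pencil (rmorph_mmap (eval2 x s : {rmorphism _ -> _})).
apply: eq_mmap => [a|]; first exact: eval2C.
by apply: ord3P; rewrite /pencil_coords /triple /= !(tnth_nth 0) /= /eval2 /= /horner_eval !hornerE.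
Qed.

Variables (n : nat) (F : {mpoly K[3]}) (f : {mpoly K[2]}).
Hypothesis Fhom : F \is n.-homog.
Hypothesis n1 : (1 < n)%N.
Hypothesis Flam : F.@[triple lam 1 0] != 0.
Hypothesis irr : irreducible_mpoly f.
Hypothesis Ff : pencil F = shear f.

(** If the resultant vanishes, F and its polar have a common factor of positive
    degree in y over K(x), and by Gauss's lemma it comes from a factorization of f.
    Its degree is at most n - 1, the degree of the polar, so that the cofactor is
    not constant either. *)
Lemma pencil_resultant_neq0 : resultant (pencil F) (pencil (polar F lam)) != 0.
Proof.
have [sF _] := pencil_top Fhom Flam.
have [sP _] := pencil_top (polar_dhomog lam Fhom) (polar_lam_neq0 Fhom n1 Flam).
rewrite prednK in sP; last exact: ltn_trans n1.
rewrite resultant_eq0; apply/negP => g1; set d := gcdp _ _ in g1.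
have /Pdiv.Idomain.dvdpP [[c q] /= c0 cE] : d %| pencil F by exact: dvdp_gcdl.
have F0 : pencil F != 0 by rewrite -size_poly_eq0 sF.
have P0 : pencil (polar F lam) != 0 by rewrite -size_poly_eq0 sP -lt0n (ltn_trans _ n1).
have sd : (size d <= n)%N by rewrite -sP dvdp_leq // dvdp_gcdr.
have [q' [d' [FE sq sd']]] := gauss_factor c0 cE.
have : (q' != 0) && (d' != 0) by rewrite -negb_or -mulf_eq0 -FE.
move=> /andP [q0 d0].
have sq1 : (1 < size q')%N.
  have := sF; rewrite FE size_mul // sd' => e; rewrite ltnNge; apply/negP => le.
  by move: e (leq_add le sd); case: (size q' + size d)%N => // k /= ->; rewrite add1n ltnn.
have small (g : {poly {poly K}}) : (msize (unshear g) <= 1)%N -> (size g <= 1)%N.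
  by move/msize1_polyC => e; rewrite -(unshearK g) e shearC size_polyC_leq1.
have [_ /(_ (unshear q') (unshear d'))] := irr.
rewrite -unshearM -FE Ff shearK => /(_ erefl) [] /small.
  by rewrite leqNgt sq1.
by rewrite leqNgt sd' g1.
Qed.

Lemma transverse_of_resultant x :
  (resultant (pencil F) (pencil (polar F lam))).[x] != 0 -> transverse F lam x.
Proof.
have [sF lF] := pencil_top Fhom Flam.
have [sP lP] := pencil_top (polar_dhomog lam Fhom) (polar_lam_neq0 Fhom n1 Flam).
rewrite -[_.[x]]/(horner_eval x _).
rewrite map_resultant ?lF ?lP /= /horner_eval ?hornerC ?polar_lam_neq0 //; last exact: (polar_lam_neq0 Fhom n1 Flam).
rewrite resultant_eq0 -leqNgt -/(horner_eval x) => le s Fs.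
have cop : coprimep (map_poly (horner_eval x) (pencil F)) (map_poly (horner_eval x) (pencil (polar F lam))).
  rewrite /coprimep eqn_leq le /= lt0n size_poly_eq0 gcdp_eq0 negb_and.
  by rewrite -lead_coef_eq0 lead_coef_map_eq lF /= /horner_eval hornerC Flam.
by rewrite -horner_pencil; apply: (coprimep_root cop); rewrite rootE horner_pencil Fs.
Qed.

Lemma transverse_pair : exists x0 x1, [/\ transverse F lam x0, transverse F lam x1 & x0 != x1].
Proof.
have R0 := pencil_resultant_neq0; set r := resultant _ _ in R0.
have [x rx] := poly_neq0_point R0.
have [|y] := @poly_neq0_point _ (r * ('X - x%:P)); first by rewrite mulf_neq0 ?polyXsubC_eq0.
rewrite hornerM mulf_eq0 negb_or => /andP [ry yx].
exists x, y; split; try exact: transverse_of_resultant.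
by move: yx; rewrite !hornerE subr_eq0 eq_sym.
Qed.
End Pencil.

(** * Nodes and the kernel of the Hessian *)

Section Nodes.
Variable K : numClosedFieldType.

Lemma dhomog_meval0 n d (G : {mpoly K[n]}) : G \is d.-homog -> (0 < d)%N -> G.@[fun=> 0] = 0.
Proof.
move=> Ghom d0; transitivity (0 ^+ d * G.@[fun=> 0]).
  by rewrite -(meval_dhomogZ 0 _ Ghom); apply: meval_eq => i; rewrite mul0r.
by rewrite expr0n eqn0Ngt d0 mul0r.
Qed.

Lemma dhomog0_meval n (G : {mpoly K[n]}) v : G \is 0.-homog -> G.@[v] = G.@[fun=> 0].
Proof.
move=> Ghom; have := meval_dhomogZ 0 v Ghom; rewrite expr0 mul1r => <-.
by apply: meval_eq => i; rewrite mul0r.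
Qed.

Lemma mderiv_mpolyX_lin n (i j : 'I_n) : ('X_j)^`M(i) = (i == j)%:R :> {mpoly K[n]}.
Proof.
rewrite mderivX mnm1E eq_sym; case: eqP => [->|_]; last by rewrite scale0r.
by rewrite scale1r submm mpolyX0.
Qed.

Lemma comp_mpolyE_XU k n (lq : n.-tuple {mpoly K[k]}) i : 'X_i \mPo lq = tnth lq i.
Proof. by rewrite comp_mpolyXU -tnth_nth. Qed.

Lemma mderiv_comp_mpoly k n (lq : n.-tuple {mpoly K[k]}) (G : {mpoly K[n]}) l :
  (G \mPo lq)^`M(l) = \sum_j (G^`M(j) \mPo lq) * (tnth lq j)^`M(l).
Proof.
elim/mpoly_ring_ind: G => [c|i|p q IHp IHq|p q IHp IHq].
- rewrite comp_mpolyC mderivC big1 // => j _; by rewrite mderivC comp_mpoly0 mul0r.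
- rewrite comp_mpolyE_XU (bigD1 i) //= big1 ?addr0 => [|j ji].
    by rewrite mderiv_mpolyX_lin eqxx comp_mpoly1 mul1r.
  by rewrite mderiv_mpolyX_lin (negbTE ji) comp_mpoly0 mul0r.
- rewrite comp_mpolyD mderivD IHp IHq -big_split; apply: eq_bigr => j _ /=.
  by rewrite mderivD comp_mpolyD mulrDl.
- rewrite rmorphM mderivM IHp IHq mulr_suml mulr_sumr -big_split; apply: eq_bigr => j _ /=.
  by rewrite mderivM comp_mpolyD !rmorphM /= mulrDl mulrAC mulrA.
Qed.

Lemma mderiv_translate (g : {mpoly K[2]}) a k :
  (translate g a)^`M(k) = translate g^`M(k) a.
Proof.
rewrite /translate mderiv_comp_mpoly (bigD1 k) //= big1 ?addr0 => [|j jk].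
  by rewrite tnth_mktuple mderivD mderivC addr0 mderiv_mpolyX_lin eqxx mulr1.
by rewrite tnth_mktuple mderivD mderivC addr0 mderiv_mpolyX_lin eq_sym (negbTE jk) mulr0.
Qed.

Lemma meval0_translate (g : {mpoly K[2]}) a : (translate g a).@[fun=> 0] = g.@[a].
Proof.
rewrite /translate comp_mpoly_meval; apply: meval_eq => i.
by rewrite tnth_mktuple mevalD mevalXU mevalC add0r.
Qed.

Lemma mderiv_dehomogenize i (G : {mpoly K[3]}) k :
  (dehomogenize i G)^`M(k) = dehomogenize i G^`M(lift i k).
Proof.
rewrite /dehomogenize mderiv_comp_mpoly (bigD1 (lift i k)) //= big1 ?addr0 => [|j].
  by rewrite tnth_mktuple liftK mderiv_mpolyX_lin eqxx mulr1.
rewrite tnth_mktuple; case: unliftP => [l ->|-> _]; last by rewrite -mpolyC1 mderivC mulr0.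
rewrite (inj_eq (@lift_inj _ i)) => lk.
by rewrite mderiv_mpolyX_lin eq_sym (negbTE lk) mulr0.
Qed.

Lemma meval_dehomogenize i (G : {mpoly K[3]}) p : p i != 0 ->
  (dehomogenize i G).@[chart_point i p] = G.@[fun j => (p i)^-1 * p j].
Proof.
move=> pi0; rewrite /dehomogenize comp_mpoly_meval; apply: meval_eq => j.
rewrite tnth_mktuple; case: unliftP => [l ->|->]; first by rewrite mevalXU mulrC.
by rewrite meval1 mulVf.
Qed.

Lemma mderiv2_meval0 n (t : {mpoly K[n]}) k l :
  pihomog mdeg 0 t = 0 -> pihomog mdeg 1 t = 0 ->
  t^`M(k)^`M(l).@[fun=> 0] = (pihomog mdeg 2 t)^`M(k)^`M(l).@[fun=> 0].
Proof.
move=> t0 t1; have le : (msize t <= (msize t).+3)%N by rewrite -addn3 leq_addr.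
rewrite {1}(pihomog_partitionE (mf := mdeg) le) !big_ord_recl /= t0 t1 !add0r.
rewrite !mderivD mevalD [X in _ + X](_ : _ = 0) ?addr0 //.
apply: (big_ind (fun u : {mpoly K[n]} => u^`M(k)^`M(l).@[fun=> 0] = 0)) => [|u v u0 v0|d _].
- by rewrite !mderiv0 meval0.
- by rewrite !mderivD mevalD u0 v0 addr0.
apply: (@dhomog_meval0 _ d.+1) => //.
exact: (dhomog_mderiv _ (dhomog_mderiv _ (pihomogP _ _ _))).
Qed.

(** The matrix a b^T + b a^T is, up to a factor 2, that of the quadratic form
    (a . y) (b . y). Independence of a and b turns its kernel into the system
    a . y = b . y = 0, of determinant [det]. *)
Lemma product_form_nondegenerate (a b y : 'I_2 -> K) :
  (forall c1 c2, (forall k, c1 * a k + c2 * b k = 0) -> c1 = 0 /\ c2 = 0) ->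
  (forall k, \sum_l (a k * b l + a l * b k) * y l = 0) -> forall l, y l = 0.
Proof.
move=> ind e; have e' k : (\sum_l b l * y l) * a k + (\sum_l a l * y l) * b k = 0.
  by rewrite -[RHS](e k) !mulr_suml -big_split; apply: eq_bigr => l _ /=; ring.
have [] := ind _ _ e'; rewrite !big_ord_recl !big_ord0 !addr0.
set j := lift _ _ => by0 ay0.
have jE : j = ord_max by apply: val_inj.
have det : a ord0 * b j - a j * b ord0 != 0.
  apply/eqP => d0.
  have [k|b00 a00] := ind (b ord0) (- a ord0).
    by move: k; apply: ord2P; rewrite -?jE; [ring|rewrite -[RHS]oppr0 -d0; ring].
  have [k|bj0 aj0] := ind (b j) (- a j).
    by move: k; apply: ord2P; rewrite -?jE; [rewrite -d0; ring|ring].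
  have [k|/eqP] := ind 1 1; last by rewrite oner_eq0.
  have na0 : a ord0 = 0 by rewrite -[a _]opprK a00 oppr0.
  have naj : a j = 0 by rewrite -[a _]opprK aj0 oppr0.
  by move: k; apply: ord2P; rewrite -?jE ?b00 ?bj0 ?na0 ?naj; ring.
apply: ord2P; rewrite -?jE; apply: (mulfI det); rewrite mulr0.
  transitivity ((a ord0 * y ord0 + a j * y j) * b j - (b ord0 * y ord0 + b j * y j) * a j); first by ring.
  by rewrite by0 ay0 !mul0r subr0.
transitivity ((b ord0 * y ord0 + b j * y j) * a ord0 - (a ord0 * y ord0 + a j * y j) * b ord0); first by ring.
by rewrite by0 ay0 !mul0r subr0.
Qed.

(** At the origin, the second derivatives of a product of two linear forms are
    those of a product of two independent vectors, symmetrized. *)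
Lemma node_hessian (g : {mpoly K[2]}) a (y : 'I_2 -> K) : ordinary_double_point g a ->
  (forall k, \sum_l g^`M(k)^`M(l).@[a] * y l = 0) -> forall l, y l = 0.
Proof.
move=> [t0 t1 [l1 [l2 [h1 h2 ind tE]]]] e.
pose c (l : {mpoly K[2]}) k := l^`M(k).@[fun=> 0].
have lE (l : {mpoly K[2]}) v : l \is 1.-homog -> l.@[v] = \sum_k v k * c l k.
  move=> hl; have := congr1 (meval v) (euler_dhomog hl); rewrite mulr1n => <-.
  rewrite raddf_sum; apply: eq_bigr => k _ /=; rewrite mevalM mevalXU.
  by rewrite (dhomog0_meval v (dhomog_mderiv k hl)).
have l0 (l : {mpoly K[2]}) : l \is 1.-homog -> l.@[fun=> 0] = 0 by move/dhomog_meval0; exact.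
apply: (@product_form_nondegenerate (c l1) (c l2)).
  move=> c1 c2 cc; apply: ind; apply: mpoly_eq0_points => v.
  rewrite mevalD !mevalZ !lE // !mulr_sumr -big_split big1 // => k _ /=.
  by rewrite mulrCA [X in _ + X]mulrCA -mulrDr cc mulr0.
move=> k; rewrite -[RHS](e k); apply: eq_bigr => l _; congr (_ * _).
rewrite -(meval0_translate _ a) -!mderiv_translate mderiv2_meval0 // tE.
by rewrite mderivM !mderivD !mderivM !mevalD !mevalM (l0 _ h1) (l0 _ h2) /c; ring.
Qed.

(** The node condition only controls the Hessian in the chart where the
    coordinate i is 1. Subtracting from y a multiple of p, which is in the kernel
    by Euler's identity, one may assume that y i = 0, and then y is a vector of
    that chart. *)
Lemma nodal_hessian_kernel n (F : {mpoly K[3]}) : F \is n.-homog -> (0 < n)%N ->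
  (forall p, projective_singular_point F p -> projective_node F p) ->
  hessian_kernel_is_point F.
Proof.
move=> Fhom n0 nodes p p0 Fp y Hy.
have [|i pi0 node] := nodes p.
  split=> //; have := congr1 (meval p) (euler_dhomog Fhom).
  rewrite mevalMn raddf_sum big1 => [/eqP|j _]; last by rewrite /= mevalM Fp mulr0.
  by rewrite eq_sym mulrn_eq0 eqn0Ngt n0 => /eqP.
have Hp j : \sum_k F^`M(j)^`M(k).@[p] * p k = 0.
  have := congr1 (meval p) (euler_dhomog (dhomog_mderiv j Fhom)).
  rewrite mevalMn Fp mul0rn => e; rewrite -[RHS]e !sum3 !mevalD !mevalM !mevalXU; ring.
exists (y i / p i); pose z j := y j - y i / p i * p j.
have zi : z i = 0 by rewrite /z divfK // subrr.
suff z0 k : z (lift i k) = 0.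
  move=> j; apply/eqP; rewrite -subr_eq0 -/(z j); apply/eqP.
  by case: (unliftP i j) => [k ->|->].
move: k; apply: (node_hessian node) => k.
under eq_bigr => l _ do rewrite !mderiv_dehomogenize meval_dehomogenize //
  (meval_dhomogZ _ _ (dhomog_mderiv _ (dhomog_mderiv _ Fhom))) -mulrA.
rewrite -mulr_sumr; apply/eqP; rewrite mulf_eq0; apply/orP; right; apply/eqP.
have : \sum_j F^`M(lift i k)^`M(j).@[p] * z j = 0.
  under eq_bigr => j _ do rewrite mulrBr mulrCA.
  by rewrite sumrB -mulr_sumr Hy Hp mulr0 subr0.
by rewrite (bigD1_ord i) //= zi mulr0 add0r.
Qed.
End Nodes.

(** * From invariant curves to syzygies *)

Section Homogenize.
Variable K : numClosedFieldType.
Implicit Types (g h : {mpoly K[2]}) (v : 'I_3 -> K).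

Definition widen3 (k : 'I_2) : 'I_3 := widen_ord (leqnSn 2) k.

(** Homogenization in a prescribed degree N, which allows P, Q and the cofactor k
    to have a degree smaller than expected. *)
Definition homogenize_to N g : {mpoly K[3]} :=
  \sum_(d < N.+1) mwiden (pihomog mdeg d g) * 'X_ord_max ^+ (N - d).

Lemma homogenizeE n g : msize g = n.+1 -> homogenize g = homogenize_to n g.
Proof. by rewrite /homogenize => ->. Qed.

Lemma dhomog_mwiden d g : g \is d.-homog -> mwiden g \is d.-homog.
Proof.
move=> gh; rewrite (mpolyE g) raddf_sum /= big_seq; apply: rpred_sum => m mg.
rewrite mwidenZ mwidenX; apply: rpredZ; rewrite dhomogX -(dhomog_mf gh mg) /=.
rewrite !mdegE big_ord_recr /= mnmwiden_ordmax addn0; apply/eqP.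
by apply: eq_bigr => k _; rewrite mnmwiden_widen.
Qed.

Lemma homogenize_to_dhomog N g : homogenize_to N g \is N.-homog.
Proof.
apply: rpred_sum => d _; have dN : (d <= N)%N by rewrite -ltnS.
have := dhomogM (dhomog_mwiden (pihomogP _ d g)) (dhomogMn (N - d) (dhomogXU K (@ord_max 2))).
by rewrite mul1n subnKC.
Qed.

Lemma meval_mwiden g v : (mwiden g).@[v] = g.@[v \o widen3].
Proof.
rewrite /mwiden /meval (rmorph_mmap (meval v : {rmorphism _ -> _})).
by apply: eq_mmap => [c|k]; rewrite /= ?mevalC // mevalXU.
Qed.

Lemma meval_homogenize_to N g v : (msize g <= N.+1)%N -> v i2 = 1 ->
  (homogenize_to N g).@[v] = g.@[v \o widen3].
Proof.
move=> gN v2; rewrite [in RHS](pihomog_partitionE (mf := mdeg) gN) /homogenize_to.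
rewrite (raddf_sum (meval v)) (raddf_sum (meval (v \o widen3))); apply: eq_bigr => d _.
by rewrite /= mevalM meval_mwiden rmorphXn /= mevalXU (_ : ord_max = i2) ?v2 ?expr1n ?mulr1 //; apply: val_inj.
Qed.

Lemma mderiv_mwiden g k : (mwiden g)^`M(widen3 k) = mwiden g^`M(k).
Proof.
elim/mpoly_ring_ind: g => [c|j|p q IHp IHq|p q IHp IHq].
- by rewrite mwidenC !mderivC mwiden0.
- by rewrite mwidenX mnmwiden1 !mderiv_mpolyX_lin -[widen3 k == _]val_eqE /= val_eqE rmorph_nat.
- by rewrite mwidenD !mderivD mwidenD IHp IHq.
- by rewrite mwidenM !mderivM mwidenD !mwidenM IHp IHq.
Qed.

Lemma meval_mderiv_homogenize_to N g v k : (msize g <= N.+1)%N -> v i2 = 1 ->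
  (homogenize_to N g)^`M(widen3 k).@[v] = g^`M(k).@[v \o widen3].
Proof.
move=> gN v2; rewrite [in RHS](pihomog_partitionE (mf := mdeg) gN) /homogenize_to.
rewrite (raddf_sum (mderiv k)) (raddf_sum (mderiv (widen3 k))).
rewrite (raddf_sum (meval v)) (raddf_sum (meval (v \o widen3))); apply: eq_bigr => d _.
rewrite /= mderivM mevalD !mevalM mderiv_mwiden meval_mwiden.
rewrite (_ : ('X_ord_max ^+ (N - d))^`M(widen3 k) = 0).
  by rewrite meval0 mulr0 addr0 rmorphXn /= mevalXU (_ : ord_max = i2) ?v2 ?expr1n ?mulr1 //; apply: val_inj.
elim: (N - d)%N => [|e IH]; first by rewrite expr0 -mpolyC1 mderivC.
rewrite exprS mderivM IH mulr0 addr0 mderiv_mpolyX_lin; case: eqP => [/(congr1 val)|_]; last by rewrite mul0r.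
by move=> /= e2; have := ltn_ord k; rewrite e2.
Qed.

(** This reduces identities between forms to the chart z = 1, where
    homogenization is invisible. *)
Lemma dhomog_eq0_affine N (G : {mpoly K[3]}) : G \is N.-homog ->
  (forall v, v i2 = 1 -> G.@[v] = 0) -> G = 0.
Proof.
move=> Gh G0; have : 'X_i2 * G = 0.
  apply: mpoly_eq0_points => v; rewrite mevalM mevalXU.
  have [->|v2] := eqVneq (v i2) 0; first by rewrite mul0r.
  have := G0 (fun i => (v i2)^-1 * v i); rewrite mulVf // => /(_ erefl).
  rewrite (meval_dhomogZ _ _ Gh) => /eqP.
  by rewrite mulf_eq0 expf_eq0 invr_eq0 (negbTE v2) andbF => /eqP ->; rewrite mulr0.
move=> /eqP; rewrite mulf_eq0 => /orP [/eqP e|/eqP //].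
have := congr1 (meval (fun=> 1)) e.
by rewrite mevalXU meval0 => /eqP; rewrite oner_eq0.
Qed.

Lemma homogenize_to_eq0 N g : (msize g <= N.+1)%N -> homogenize_to N g = 0 -> g = 0.
Proof.
move=> gN g0; apply: mpoly_eq0_points => v.
have := meval_homogenize_to (v := fun i : 'I_3 => oapp v 1 (unlift ord_max i)) gN.
rewrite g0 meval0 (_ : i2 = ord_max); last exact: val_inj.
rewrite unlift_none => /(_ erefl) ->; apply: meval_eq => k /=.
by rewrite (_ : widen3 k = lift ord_max k) ?liftK //; apply: val_inj; rewrite /= /bump leqNgt ltn_ord.
Qed.

Lemma msize_mderiv n (p : {mpoly K[n]}) i : (msize p^`M(i) <= (msize p).-1)%N.
Proof.
rewrite msizeE; apply/bigmax_leqP_seq => m mp _.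
have /msize_mdeg_lt : (m + U_(i))%MM \in msupp p.
  rewrite mcoeff_msupp; move: mp; rewrite mcoeff_msupp mcoeff_mderiv.
  by apply: contraNneq => ->; rewrite mul0rn.
by rewrite mdegD mdeg1 addn1; case: (msize p).
Qed.

Lemma msizeM_leq n (p q : {mpoly K[n]}) : (msize (p * q)%R <= (msize p + msize q).-1)%N.
Proof.
have [->|p0] := eqVneq p 0; first by rewrite mul0r msize0.
have [->|q0] := eqVneq q 0; first by rewrite mulr0 msize0.
by rewrite msizeM.
Qed.

Variables (m n : nat) (P Q f k : {mpoly K[2]}).
Hypothesis m1 : (1 < m)%N.
Hypothesis PQm : maxn (msize P) (msize Q) = m.+1.
Hypothesis fn : msize f = n.+1.
Hypothesis n0 : (0 < n)%N.
Hypothesis inv : P * f^`M(0) + Q * f^`M(1) = k * f.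

Lemma msize_cofactor : (msize k <= m)%N.
Proof.
have [->|k0] := eqVneq k 0; first by rewrite msize0.
have f0 : f != 0 by rewrite -msize_poly_eq0 fn.
have := msizeM k0 f0; rewrite -inv fn addnS /= => e.
rewrite -(leq_add2r n) -e; apply: leq_trans (msizeD_le _ _) _.
have b (R : {mpoly K[2]}) i : (msize R <= m.+1)%N -> (msize (R * f^`M(i))%R <= m + n)%N.
  move=> Rm; apply: leq_trans (msizeM_leq _ _) _.
  have := leq_add Rm (msize_mderiv f i); rewrite fn /= addSn.
  by case: (msize R + _)%N.
by rewrite geq_max !b // -PQm ?leq_maxl ?leq_maxr.
Qed.

Let F := homogenize_to n f.
Let P' := homogenize_to m P.
Let Q' := homogenize_to m Q.
Let k' := homogenize_to m.-1 k.

(** The homogeneous vector field (P', Q', 0) multiplies F by k'; subtracting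
    k' / n times the Euler field, which multiplies F by k', gives a field that
    annihilates F. *)
Definition invariant_syzygy : 'I_3 -> {mpoly K[3]} :=
  triple (P' - n%:R^-1 *: ('X_i0 * k')) (Q' - n%:R^-1 *: ('X_i1 * k')) (- (n%:R^-1 *: ('X_i2 * k'))).

Lemma invariant_homogeneous : P' * F^`M(i0) + Q' * F^`M(i1) = k' * F.
Proof.
have mP : (msize P <= m.+1)%N by rewrite -PQm leq_maxl.
have mQ : (msize Q <= m.+1)%N by rewrite -PQm leq_maxr.
have mk : (msize k <= m.-1.+1)%N by rewrite prednK ?msize_cofactor // ltnW.
have mf : (msize f <= n.+1)%N by rewrite fn.
apply/eqP; rewrite -subr_eq0; apply/eqP.
apply: (@dhomog_eq0_affine (m.-1 + n)).
  have mn : (m.-1 + n = m + n.-1)%N by rewrite -[RHS]addn0; lia.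
  have hm g i : homogenize_to m g * F^`M(i) \is (m.-1 + n).-homog.
    rewrite mn; apply: dhomogM; first exact: homogenize_to_dhomog.
    exact/dhomog_mderiv/homogenize_to_dhomog.
  apply: rpredB; first by apply: rpredD; exact: hm.
  by apply: dhomogM; exact: homogenize_to_dhomog.
move=> v v2.
have -> : i0 = widen3 0 by apply: val_inj.
have -> : i1 = widen3 1 by apply: val_inj.
rewrite mevalB mevalD !mevalM !meval_mderiv_homogenize_to // !meval_homogenize_to //.
by rewrite -!mevalM -mevalD inv subrr.
Qed.

Lemma invariant_syzygyP : \sum_i invariant_syzygy i * F^`M(i) = 0.
Proof.
have e := euler_dhomog (homogenize_to_dhomog n f).
rewrite sum3 /invariant_syzygy /triple !(tnth_nth 0) /=.
have -> : (P' - n%:R^-1 *: ('X_i0 * k')) * F^`M(i0) + (Q' - n%:R^-1 *: ('X_i1 * k')) * F^`M(i1) +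
    - (n%:R^-1 *: ('X_i2 * k')) * F^`M(i2) =
    P' * F^`M(i0) + Q' * F^`M(i1) - k' * (n%:R^-1 *: \sum_i 'X_i * F^`M(i)).
  rewrite sum3 -!mul_mpolyC; ring.
rewrite e invariant_homogeneous -scaler_nat scalerA mulVf ?scale1r ?subrr //.
by rewrite pnatr_eq0 -lt0n.
Qed.

Lemma invariant_syzygy_dhomog i : invariant_syzygy i \is m.-homog.
Proof.
have hk j : n%:R^-1 *: ('X_j * k') \is m.-homog.
  apply: rpredZ; have := dhomogM (dhomogXU K j) (homogenize_to_dhomog m.-1 k).
  by rewrite add1n (prednK (ltnW m1)).
move: i; apply: ord3P; rewrite /invariant_syzygy /triple !(tnth_nth 0) /=.
- by apply: rpredB; [exact: homogenize_to_dhomog|exact: hk].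
- by apply: rpredB; [exact: homogenize_to_dhomog|exact: hk].
- by rewrite rpredN; exact: hk.
Qed.

(** The last component is a multiple of z k', so V = 0 forces k' = 0 and then
    P = Q = 0, against the degree of the vector field. *)
Lemma invariant_syzygy_neq0 : exists i, invariant_syzygy i != 0.
Proof.
apply/existsP; apply: contraT; rewrite negb_exists => /forallP /= V0.
have {}V0 i : invariant_syzygy i = 0 by apply/eqP; have := V0 i; rewrite negbK.
have mP : (msize P <= m.+1)%N by rewrite -PQm leq_maxl.
have mQ : (msize Q <= m.+1)%N by rewrite -PQm leq_maxr.
have k0 : k' = 0.
  have := V0 i2; rewrite /invariant_syzygy /triple (tnth_nth 0) /= => /eqP.
  rewrite oppr_eq0 scaler_eq0 invr_eq0 pnatr_eq0 eqn0Ngt n0 /= mulf_eq0.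
  case/orP => [/eqP e|/eqP //]; have := congr1 (meval (fun=> 1)) e.
  by rewrite mevalXU meval0 => /eqP; rewrite oner_eq0.
have P0 : P = 0.
  apply: (homogenize_to_eq0 mP); have := V0 i0.
  by rewrite /invariant_syzygy /triple (tnth_nth 0) /= k0 mulr0 scaler0 subr0.
have Q0 : Q = 0.
  apply: (homogenize_to_eq0 mQ); have := V0 i1.
  by rewrite /invariant_syzygy /triple (tnth_nth 0) /= k0 mulr0 scaler0 subr0.
by move: PQm; rewrite P0 Q0 msize0.
Qed.
End Homogenize.

(** * The degree bound *)

Section DegreeBound.
Variable K : numClosedFieldType.

Lemma pihomog_msize_neq0 n (f : {mpoly K[2]}) : msize f = n.+1 -> pihomog mdeg n f != 0.
Proof.
move=> fn; have f0 : f != 0 by rewrite -msize_poly_eq0 fn.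
apply/eqP => top0; have := mleadc_eq0 f; rewrite (negbTE f0).
rewrite {2}(pihomog_partitionE (mf := mdeg) (leqnn _) : f = _) fn big_ord_recr /= top0 addr0.
rewrite raddf_sum big1 ?eqxx // => d _ /=.
rewrite (dhomog_nemf_coeff (pihomogP _ _ _)) //= neq_ltn; apply/orP; right.
by rewrite -ltnS (leq_ltn_trans (ltn_ord d)) // -fn -mlead_deg.
Qed.

Lemma meval_homogenize_infinity n (f : {mpoly K[2]}) v : v i2 = 0 ->
  (homogenize_to n f).@[v] = (pihomog mdeg n f).@[v \o widen3].
Proof.
move=> v2; rewrite /homogenize_to big_ord_recr /= subnn expr0 mulr1 mevalD meval_mwiden.
rewrite (raddf_sum (meval v)) big1 ?add0r // => d _ /=.
rewrite mevalM rmorphXn /= mevalXU (_ : ord_max = i2) ?v2; last exact: val_inj.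
by rewrite expr0n subn_eq0 leqNgt ltn_ord mulr0.
Qed.

(** The top form of f times y does not vanish at some (a0, a1); then
    lam = a0 / a1. *)
Lemma exists_noncurve_direction n (f : {mpoly K[2]}) : msize f = n.+1 ->
  exists lam, (homogenize_to n f).@[triple lam 1 0] != 0.
Proof.
move=> fn; have top0 := pihomog_msize_neq0 fn.
have X1 : 'X_ord_max != 0 :> {mpoly K[2]}.
  apply/eqP => /(congr1 (meval (fun=> 1))) /eqP; by rewrite mevalXU meval0 oner_eq0.
have [a] := mpoly_neq0_point (mulf_neq0 X1 top0).
rewrite mevalM mevalXU mulf_eq0 negb_or => /andP [a1 aT].
exists (a ord0 / a ord_max).
apply: contraNneq aT => /(congr1 ( *%R (a ord_max ^+ n))).
rewrite mulr0 -(meval_dhomogZ _ _ (homogenize_to_dhomog n f)) meval_homogenize_infinity; last first.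
  by rewrite /triple (tnth_nth 0) /= mulr0.
move=> e; apply/eqP; rewrite -[RHS]e; apply: meval_eq.
by apply: ord2P; rewrite /triple /= (tnth_nth 0) /= ?mulr1 // mulrC divfK.
Qed.

Lemma pencil_homogenize n (f : {mpoly K[2]}) lam : msize f = n.+1 ->
  pencil lam (homogenize_to n f) = shear lam f.
Proof.
move=> fn; rewrite /pencil /shear.
rewrite [in RHS](pihomog_partitionE (mf := mdeg) (leqnn _) : f = _) fn /homogenize_to.
rewrite !raddf_sum; apply: eq_bigr => d _ /=.
rewrite rmorphM rmorphXn /= mmapXU (_ : ord_max = i2); last exact: val_inj.
rewrite {2}/pencil_coords /triple (tnth_nth 0) /= expr1n mulr1.
rewrite /mwiden (rmorph_mmap (mmap (polyC \o polyC) (pencil_coords lam) : {rmorphism _ -> _})).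
by apply: eq_mmap => [c|k] /=; rewrite ?mmapC // mmapXU.
Qed.

Lemma nodal_invariant_curve_degree (m n : nat) (P Q f : {mpoly K[2]}) :
  (1 < m)%N -> maxn (msize P) (msize Q) = m.+1 -> invariant_curve P Q f ->
  msize f = n.+1 ->
  (forall p, projective_singular_point (homogenize f) p -> projective_node (homogenize f) p) ->
  (n <= 2 * (m + 1))%N.
Proof.
move=> m1 PQm [irr [k inv]] fn; rewrite (homogenizeE fn) => nodes.
rewrite leqNgt addn1; apply/negP => nm.
have n1 : (1 < n)%N by apply: leq_trans nm; rewrite mul2n -addnn addSn.
have n0 : (0 < n)%N by exact: ltnW.
have Fhom := homogenize_to_dhomog n f.
have [lam Flam] := exists_noncurve_direction fn.
have [x0 [x1 [tr0 tr1 x01]]] := transverse_pair Fhom n1 Flam irr (pencil_homogenize lam fn).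
have [i /eqP []] := invariant_syzygy_neq0 k PQm n0.
have ker := nodal_hessian_kernel Fhom n0 nodes.
have Vhom := invariant_syzygy_dhomog n P Q k m1.
exact: (low_degree_syzygy_eq0 Fhom Vhom (invariant_syzygyP m1 PQm fn n0 inv) nm Flam tr0 tr1 x01 ker).
Qed.
End DegreeBound.

Theorem corollary3 (R : realType) (m n : nat) (P Q f : {mpoly R[i][2]})
  (hm : (1 < m)%N)
  (hdeg : maxn (msize P) (msize Q) = m.+1)
  (hPQ : no_common_factor P Q)
  (hf : invariant_curve P Q f)
  (hn : msize f = n.+1)
  (hnodes : forall p : 'I_3 -> R[i],
     projective_singular_point (homogenize f) p ->
     projective_node (homogenize f) p) :
  (n <= 2 * (m + 1))%N.
Proof.
exact: nodal_invariant_curve_degree hm hdeg hf hn hnodes.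
Qed.
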